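(* Let $q>0$ and let $\mathcal{A}=\mathbb{C}\langle x,x^*\mid xx^*=qx^*x\rangle$. There exists a positive linear functional on $\mathcal{A}$ which is not a $q$-moment functional.
   Context: $\mathcal{A}$ is the unital complex $*$-algebra with single generator $x$ and defining relation $xx^*=qx^*x$. A linear functional $F$ on $\mathcal{A}$ is positive if $F(a^*a)\ge0$ for all $a\in\mathcal{A}$. A densely defined operator $X$ on a Hilbert space is called $q$-normal if $\mathcal{D}(X)=\mathcal{D}(X^* )$ and $\|X^*f\|=\sqrt q\,\|Xf\|$ for all $f\in\mathcal{D}(X)$. Put $\mathcal{D}^\infty(X)=\bigcap_{n\ge1}\mathcal{D}(X^n)$. A $*$-representation $\pi$ of $\mathcal{A}$ on a dense linear subspace $\mathcal{D}(\pi)$ of a Hilbert space is an algebra homomorphism of $\mathcal{A}$ into the linear operators on $\mathcal{D}(\pi)$ with $\pi(1)=I$ and $\langle\pi(a)\varphi,\psi\rangle=\langle\varphi,\pi(a^* )\psi\rangle$ for $\varphi,\psi\in\mathcal{D}(\pi)$, $a\in\mathcal{A}$. It is well-behaved if there is a $q$-normal operator $X$ with $\mathcal{D}(\pi)=\mathcal{D}^\infty(X)$ and $\pi(x)=X\upharpoonright\mathcal{D}^\infty(X)$. A linear functional $F$ on $\mathcal{A}$ is a $q$-moment functional if there exist a well-behaved $*$-representation $\pi$ of $\mathcal{A}$ and a vector $\xi\in\mathcal{D}(\pi)$ with $F(a)=\langle\pi(a)\xi,\xi\rangle$ for all $a\in\mathcal{A}$. *)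

(* Defs.v *)
From HB Require Import structures.
From mathcomp Require Import all_boot all_order all_algebra.
From mathcomp Require Import generic_quotient sesquilinear complex.
From mathcomp Require Import boolp classical_sets reals topology normedtype.

Set Implicit Arguments.
Unset Strict Implicit.
Unset Printing Implicit Defensive.

Import Order.TTheory GRing.Theory Num.Theory.

Local Open Scope classical_set_scope.
Local Open Scope ring_scope.
Local Open Scope complex_scope.
Local Open Scope quotient_scope.

(* The algebra C<x, x^* | x x^* = q x^* x> is built as the quotient of the
   noncommutative polynomial expressions in two letters by the least congruence
   [qeq] that contains the axioms of unital associative C-algebras and the
   defining relation.  Scaling by c is multiplication by the constant [qcst c]. *)
Inductive qexpr (R : realType) : Type :=
| qcst of R[i]
| qx
| qxs
| qadd of qexpr R & qexpr R
| qmul of qexpr R & qexpr R.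

Arguments qx {R}.
Arguments qxs {R}.

HB.instance Definition _ (R : realType) := gen_eqMixin (qexpr R).
HB.instance Definition _ (R : realType) := gen_choiceMixin (qexpr R).

Inductive qeq (R : realType) (q : R) : qexpr R -> qexpr R -> Prop :=
| qeq_refl s : qeq q s s
| qeq_sym s t : qeq q s t -> qeq q t s
| qeq_trans s t u : qeq q s t -> qeq q t u -> qeq q s u
| qeq_add s s' t t' :
    qeq q s s' -> qeq q t t' -> qeq q (qadd s t) (qadd s' t')
| qeq_mul s s' t t' :
    qeq q s s' -> qeq q t t' -> qeq q (qmul s t) (qmul s' t')
| qeq_addA s t u : qeq q (qadd s (qadd t u)) (qadd (qadd s t) u)
| qeq_addC s t : qeq q (qadd s t) (qadd t s)
| qeq_add0 s : qeq q (qadd (qcst 0) s) s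
| qeq_addN s : qeq q (qadd (qmul (qcst (-1)) s) s) (qcst 0)
| qeq_mulA s t u : qeq q (qmul s (qmul t u)) (qmul (qmul s t) u)
| qeq_mul1 s : qeq q (qmul (qcst 1) s) s
| qeq_mulDl s t u : qeq q (qmul (qadd s t) u) (qadd (qmul s u) (qmul t u))
| qeq_mulDr s t u : qeq q (qmul s (qadd t u)) (qadd (qmul s t) (qmul s u))
| qeq_cstD a b : qeq q (qcst (a + b)) (qadd (qcst a) (qcst b))
| qeq_cstM a b : qeq q (qcst (a * b)) (qmul (qcst a) (qcst b))
| qeq_cstC a s : qeq q (qmul (qcst a) s) (qmul s (qcst a))
| qeq_rel : qeq q (qmul qx qxs) (qmul (qcst q%:C) (qmul qxs qx)).

Section QuantumPlane.
Variables (R : realType) (q : R).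

Let e (s t : qexpr R) : bool := `[< qeq q s t >].

Let e_refl : reflexive e.
Proof. by move=> s; apply/asboolP; exact: qeq_refl. Qed.

Let e_sym : symmetric e.
Proof. by move=> s t; apply/asboolP/asboolP; exact: qeq_sym. Qed.

Let e_trans : transitive e.
Proof.
move=> t s u /asboolP st /asboolP tu; apply/asboolP; exact: qeq_trans tu.
Qed.

Definition qeq_equiv : equiv_rel (qexpr R) := EquivRel e e_refl e_sym e_trans.

Definition qplane : Type := {eq_quot qeq_equiv}.

HB.instance Definition _ := Choice.on qplane.

Definition qclass (s : qexpr R) : qplane := \pi_({eq_quot qeq_equiv}) s.

Definition qrep (a : qplane) : qexpr R := repr (a : {eq_quot qeq_equiv}).

Lemma qclassP s t : qclass s = qclass t <-> qeq q s t.
Proof. by split=> [/eqquotP/asboolP|H]; last apply/eqquotP/asboolP. Qed.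

Lemma qrepK a : qclass (qrep a) = a.
Proof. exact: reprK. Qed.

Lemma qclassK s : qeq q (qrep (qclass s)) s.
Proof. by apply/qclassP; rewrite qrepK. Qed.

Lemma qclass_surj (P : qplane -> Prop) :
  (forall s, P (qclass s)) -> forall a, P a.
Proof. by move=> Ps a; rewrite -(qrepK a). Qed.

Definition qplane_add (a b : qplane) := qclass (qadd (qrep a) (qrep b)).
Definition qplane_mul (a b : qplane) := qclass (qmul (qrep a) (qrep b)).
Definition qplane_scale (c : R[i]) (a : qplane) := qclass (qmul (qcst c) (qrep a)).

Let addE s t : qplane_add (qclass s) (qclass t) = qclass (qadd s t).
Proof. by apply/qclassP; apply: qeq_add; exact: qclassK. Qed.

Let mulE s t : qplane_mul (qclass s) (qclass t) = qclass (qmul s t).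
Proof. by apply/qclassP; apply: qeq_mul; exact: qclassK. Qed.

Let scaleE c s : qplane_scale c (qclass s) = qclass (qmul (qcst c) s).
Proof.
by apply/qclassP; apply: qeq_mul; [exact: qeq_refl | exact: qclassK].
Qed.

Let addA : associative qplane_add.
Proof.
elim/qclass_surj=> s; elim/qclass_surj=> t; elim/qclass_surj=> u.
by rewrite !addE; apply/qclassP; exact: qeq_addA.
Qed.

Let addC : commutative qplane_add.
Proof.
elim/qclass_surj=> s; elim/qclass_surj=> t.
by rewrite !addE; apply/qclassP; exact: qeq_addC.
Qed.

Let add0 : left_id (qclass (qcst 0)) qplane_add.
Proof.
by elim/qclass_surj=> s; rewrite addE; apply/qclassP; exact: qeq_add0.
Qed.

Let addN : left_inverse (qclass (qcst 0)) (qplane_scale (-1)) qplane_add.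
Proof.
by elim/qclass_surj=> s; rewrite scaleE addE; apply/qclassP; exact: qeq_addN.
Qed.

HB.instance Definition _ := GRing.isZmodule.Build qplane addA addC add0 addN.

Let mulA : associative qplane_mul.
Proof.
elim/qclass_surj=> s; elim/qclass_surj=> t; elim/qclass_surj=> u.
by rewrite !mulE; apply/qclassP; exact: qeq_mulA.
Qed.

Let mul1 : left_id (qclass (qcst 1)) qplane_mul.
Proof.
by elim/qclass_surj=> s; rewrite mulE; apply/qclassP; exact: qeq_mul1.
Qed.

Let mulx1 : right_id (qclass (qcst 1)) qplane_mul.
Proof.
elim/qclass_surj=> s; rewrite mulE; apply/qclassP.
exact: qeq_trans (qeq_sym (qeq_cstC q 1 s)) (qeq_mul1 q s).
Qed.

Let mulDl : left_distributive qplane_mul qplane_add.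
Proof.
elim/qclass_surj=> s; elim/qclass_surj=> t; elim/qclass_surj=> u.
by rewrite !(addE, mulE); apply/qclassP; exact: qeq_mulDl.
Qed.

Let mulDr : right_distributive qplane_mul qplane_add.
Proof.
elim/qclass_surj=> s; elim/qclass_surj=> t; elim/qclass_surj=> u.
by rewrite !(addE, mulE); apply/qclassP; exact: qeq_mulDr.
Qed.

Fixpoint qexpr_eval (B : algType R[i]) (b b' : B) (s : qexpr R) : B :=
  match s with
  | qcst c => c%:A
  | qx => b
  | qxs => b'
  | qadd s t => qexpr_eval b b' s + qexpr_eval b b' t
  | qmul s t => qexpr_eval b b' s * qexpr_eval b b' t
  end.

Lemma qexpr_eval_qeq (B : algType R[i]) (b b' : B) (s t : qexpr R) :
  b * b' = q%:C *: (b' * b) -> qeq q s t ->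
  qexpr_eval b b' s = qexpr_eval b b' t.
Proof.
move=> bb'; elim=> //=.
- by move=> ? ? ? _ -> _ ->.
- by move=> ? ? ? ? _ -> _ ->.
- by move=> ? ? ? ? _ -> _ ->.
- by move=> ? ? ?; rewrite addrA.
- by move=> ? ?; rewrite addrC.
- by move=> ?; rewrite scale0r add0r.
- by move=> ?; rewrite scaleN1r mulN1r addNr scale0r.
- by move=> ? ? ?; rewrite mulrA.
- by move=> ?; rewrite scale1r mul1r.
- by move=> ? ? ?; rewrite mulrDl.
- by move=> ? ? ?; rewrite mulrDr.
- by move=> ? ?; rewrite scalerDl.
- by move=> a c; rewrite -scalerAl mul1r scalerA.
- by move=> ? ?; rewrite -scalerAl mul1r -scalerAr mulr1.
- by rewrite bb' -scalerAl mul1r.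
Qed.

Let one_neq0 : qclass (qcst 1) != qclass (qcst 0).
Proof.
apply/eqP => /qclassP /(@qexpr_eval_qeq R[i]^o 0 0).
by rewrite mulr0 scaler0 /= scale1r scale0r => /(_ erefl)/eqP; rewrite oner_eq0.
Qed.

HB.instance Definition _ := GRing.Zmodule_isNzRing.Build qplane
  mulA mul1 mulx1 mulDl mulDr one_neq0.

Let scaleA a b (u : qplane) :
  qplane_scale a (qplane_scale b u) = qplane_scale (a * b) u.
Proof.
elim/qclass_surj: u => s; rewrite !scaleE; apply/qclassP.
apply: (qeq_trans (qeq_mulA _ _ _ _)); apply: qeq_mul (qeq_refl _ _).
exact/qeq_sym/qeq_cstM.
Qed.

Let scale1 : left_id 1 qplane_scale.
Proof.
by elim/qclass_surj=> s; rewrite scaleE; apply/qclassP; exact: qeq_mul1.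
Qed.

Let scaleDr : right_distributive qplane_scale +%R.
Proof.
move=> c; elim/qclass_surj=> s; elim/qclass_surj=> t.
rewrite /GRing.add /= addE !scaleE addE.
by apply/qclassP; exact: qeq_mulDr.
Qed.

Let scaleDl u : {morph qplane_scale^~ u : a b / a + b}.
Proof.
elim/qclass_surj: u => s a b /=; rewrite !scaleE [RHS]addE; apply/qclassP.
apply: qeq_trans (qeq_mulDl _ _ _ _); apply: qeq_mul (qeq_refl _ _).
exact: qeq_cstD.
Qed.

HB.instance Definition _ := GRing.Zmodule_isLmodule.Build R[i] qplane
  scaleA scale1 scaleDr scaleDl.

Let scaleAl (c : R[i]) (u v : qplane) : c *: (u * v) = c *: u * v.
Proof.
elim/qclass_surj: u => s; elim/qclass_surj: v => t.
rewrite [s in c *: s]mulE [LHS]scaleE [in RHS]/(c *: _) /= scaleE [RHS]mulE.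
by apply/qclassP; exact: qeq_mulA.
Qed.

HB.instance Definition _ := GRing.Lmodule_isLalgebra.Build R[i] qplane scaleAl.

Let scaleAr (c : R[i]) (u v : qplane) : c *: (u * v) = u * (c *: v).
Proof.
elim/qclass_surj: u => s; elim/qclass_surj: v => t.
rewrite [s in c *: s]mulE [LHS]scaleE [in RHS]/(c *: _) /= scaleE [RHS]mulE.
apply/qclassP; apply: (qeq_trans (qeq_mulA _ _ _ _)).
apply: qeq_trans (qeq_sym (qeq_mulA _ _ _ _)).
exact: qeq_mul (qeq_cstC _ _ _) (qeq_refl _ _).
Qed.

HB.instance Definition _ := GRing.Lalgebra_isAlgebra.Build R[i] qplane scaleAr.

Lemma qclassD s t : qclass (qadd s t) = qclass s + qclass t.
Proof. by rewrite [RHS]addE. Qed.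

Lemma qclassM s t : qclass (qmul s t) = qclass s * qclass t.
Proof. by rewrite [RHS]mulE. Qed.

Lemma qclass_cst c : qclass (qcst c) = c%:A.
Proof.
rewrite [RHS]scaleE; apply/qclassP.
by apply: qeq_trans (qeq_cstM _ _ _); rewrite mulr1; exact: qeq_refl.
Qed.

Fixpoint qexpr_star (s : qexpr R) : qexpr R :=
  match s with
  | qcst c => qcst (Num.conj c)
  | qx => qxs
  | qxs => qx
  | qadd s t => qadd (qexpr_star s) (qexpr_star t)
  | qmul s t => qmul (qexpr_star t) (qexpr_star s)
  end.

Lemma qexpr_starK : involutive qexpr_star.
Proof. by elim=> //= [c|s -> t ->|s -> t ->] //; rewrite conjCK. Qed.

Lemma qexpr_star_qeq s t : qeq q s t -> qeq q (qexpr_star s) (qexpr_star t).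
Proof.
elim=> //=; try by move=> *; exact: qeq_refl.
- by move=> ? ? _; exact: qeq_sym.
- by move=> ? ? ? _ + _; exact: qeq_trans.
- by move=> ? ? ? ? _ ? _ ?; exact: qeq_add.
- by move=> ? ? ? ? _ ? _ ?; exact: qeq_mul.
- by move=> ? ? ?; exact: qeq_addA.
- by move=> ? ?; exact: qeq_addC.
- by move=> ?; rewrite conjC0; exact: qeq_add0.
- move=> s'; rewrite rmorphN1 conjC0.
  apply: qeq_trans (qeq_addN _ (qexpr_star s')).
  by apply: qeq_add (qeq_refl _ _); exact/qeq_sym/qeq_cstC.
- by move=> ? ? ?; exact/qeq_sym/qeq_mulA.
- move=> ?; rewrite conjC1.
  exact: qeq_trans (qeq_sym (qeq_cstC _ _ _)) (qeq_mul1 _ _).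
- by move=> ? ? ?; exact: qeq_mulDr.
- by move=> ? ? ?; exact: qeq_mulDl.
- by move=> ? ?; rewrite rmorphD; exact: qeq_cstD.
- by move=> ? ?; rewrite rmorphM mulrC; exact: qeq_cstM.
- by move=> ? ?; exact/qeq_sym/qeq_cstC.
- have -> : Num.conj q%:C = q%:C by apply/CrealP/complex_realP; exists q.
  exact: qeq_trans (qeq_rel _) (qeq_cstC _ _ _).
Qed.

Definition qplane_star (a : qplane) : qplane := qclass (qexpr_star (qrep a)).

Definition qplane_x : qplane := qclass qx.

Lemma qplane_star_class s : qplane_star (qclass s) = qclass (qexpr_star s).
Proof. by apply/qclassP; apply: qexpr_star_qeq; exact: qclassK. Qed.

Lemma qplane_starK : involutive qplane_star.
Proof. by elim/qclass_surj=> s; rewrite !qplane_star_class qexpr_starK. Qed.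

Lemma qplane_starD : {morph qplane_star : a b / a + b}.
Proof.
elim/qclass_surj=> s; elim/qclass_surj=> t.
by rewrite -qclassD !qplane_star_class -qclassD.
Qed.

Lemma qplane_starM a b : qplane_star (a * b) = qplane_star b * qplane_star a.
Proof.
elim/qclass_surj: a => s; elim/qclass_surj: b => t.
by rewrite -qclassM !qplane_star_class -qclassM.
Qed.

Lemma qplane_starZ c a :
  qplane_star (c *: a) = Num.conj c *: qplane_star a.
Proof.
elim/qclass_surj: a => s; rewrite -mulr_algl -qclass_cst qplane_starM.
by rewrite !qplane_star_class /= qclass_cst mulr_algr.
Qed.

Lemma qplane_relation :
  qplane_x * qplane_star qplane_x = q%:C *: (qplane_star qplane_x * qplane_x).
Proof.
rewrite qplane_star_class -!qclassM -mulr_algl -qclass_cst -qclassM.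
by apply/qclassP; exact: qeq_rel.
Qed.

Definition positive_functional (F : {scalar qplane}) : Prop :=
  forall a : qplane, 0 <= F (qplane_star a * a).

End QuantumPlane.

(* The inner product is linear in its first argument and conjugate-linear in the
   second. *)
Record hilbertSpace (R : realType) := HilbertSpace {
  hilbert_sort :> completeNormedModType R[i];
  inner : {dot hilbert_sort for Num.conj};
  sqr_norm_inner : forall v : hilbert_sort, `|v| ^+ 2 = inner v v }.

Section Operators.
Variables (R : realType) (H : hilbertSpace R).

Definition is_subspace (D : set H) : Prop :=
  D 0 /\ forall (c : R[i]) f g, D f -> D g -> D (c *: f + g).

(* A linear operator defined on a subspace of [H]; the values of [op_fun] outside
   [op_dom] are irrelevant. *)
Record linear_operator := LinearOperator {
  op_dom : set H;
  op_fun :> H -> H;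
  op_dom_subspace : is_subspace op_dom;
  op_fun_linear : forall (c : R[i]) f g, op_dom f -> op_dom g ->
    op_fun (c *: f + g) = c *: op_fun f + op_fun g }.

Definition densely_defined (X : linear_operator) : Prop := dense (op_dom X).

Definition adjoint_graph (X : linear_operator) (g h : H) : Prop :=
  forall f, op_dom X f -> inner H (X f) g = inner H f h.

Definition adjoint_dom (X : linear_operator) : set H :=
  [set g | exists h, adjoint_graph X g h].

(* X^* g is the only h with [adjoint_graph X g h] when X is densely defined and
   g lies in [adjoint_dom X]. *)
Definition adjoint (X : linear_operator) (g : H) : H :=
  xget 0 [set h | adjoint_graph X g h].

Definition q_normal (q : R) (X : linear_operator) : Prop :=
  [/\ densely_defined X,
      op_dom X = adjoint_dom X &
      forall f, op_dom X f -> `|adjoint X f| = (Num.sqrt q)%:C * `|X f|].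

Fixpoint pow_dom (X : linear_operator) (n : nat) : set H :=
  if n is n'.+1 then [set f | op_dom X f /\ pow_dom X n' (X f)] else setT.

Definition smooth_dom (X : linear_operator) : set H :=
  \bigcap_(n in [set n | (1 <= n)%N]) pow_dom X n.

(* [D] is the domain of the representation; the values of [pi a] outside [D] are
   irrelevant. *)
Record is_star_rep (q : R) (D : set H) (pi : qplane q -> H -> H) : Prop := {
  star_rep_dense : dense D;
  star_rep_subspace : is_subspace D;
  star_rep_stable : forall a f, D f -> D (pi a f);
  star_rep_op_linear : forall a (c : R[i]) f g, D f -> D g ->
    pi a (c *: f + g) = c *: pi a f + pi a g;
  star_rep_linear : forall (c : R[i]) a b f, D f ->
    pi (c *: a + b) f = c *: pi a f + pi b f;
  star_rep_mul : forall a b f, D f -> pi (a * b) f = pi a (pi b f);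
  star_rep_one : forall f, D f -> pi 1 f = f;
  star_rep_star : forall a f g, D f -> D g ->
    inner H (pi a f) g = inner H f (pi (qplane_star a) g) }.

Definition well_behaved (q : R) (D : set H) (pi : qplane q -> H -> H) : Prop :=
  exists X : linear_operator,
    [/\ q_normal q X, D = smooth_dom X &
        forall f, D f -> pi (qplane_x q) f = X f].

End Operators.

Definition q_moment_functional (R : realType) (q : R) (F : {scalar qplane q}) :
    Prop :=
  exists (H : hilbertSpace R) (D : set H) (pi : qplane q -> H -> H) (xi : H),
    [/\ is_star_rep D pi, well_behaved D pi, D xi &
        forall a, F a = inner H (pi a xi) xi].

(* Main.v *)
Require Import Defs.
From HB Require Import structures.
From mathcomp Require Import all_boot all_order all_algebra.
From mathcomp Require Import sesquilinear complex.
From mathcomp Require Import boolp classical_sets reals topology normedtype.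
From mathcomp Require Import ring lra zify.

(** Write [x'] for the adjoint of the generator [x] and [N = x' x]; then
    [x x' = q N] and [x N = q N x].  As with the Motzkin polynomial, the point is
    an element that is nonnegative in all well-behaved representations and
    negative under some functional that is nonnegative on all [a' a].  With
    [v = x N - q^-3 x'^3], [b = (q + q^-3) / 2] and a large constant [k], it is
      [k (1 - N)^2 + 1/8 + v' v / 2 - N^2 + b (x^4 + x'^4) / 2].

    Nonnegativity.  Consider first a vector [xi = x h].  Put
    [H = x^2 - q^-2 x'^2], [g = q^-1 N h] and [h' = g - h].  Then [v xi = H g]
    and [x h' = (N - 1) xi], while the terms in [N^2], [x^4] and [x'^4] amount to
    [- Re <H g, H h> / 2].  So the last three summands give
    [|H h'|^2 / 2 + Re <H h', H h> / 2].  Moving one factor [x] or [x'] across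
    bounds the last product by a multiple of [|x h'| |N xi|], which the first two
    summands absorb ([witness_form_range]).  A general smooth [xi] is reduced to
    this case by the resolvent: [u = (1 + s x x')^-1 xi] exists by energy
    minimisation ([resolvent]), it is again smooth because [X] carries resolvents
    to resolvents ([weak_solX]), and [xi - u = x (s x' u)].  As [s] grows, [x u],
    [x^2 u] and [x^3 u] tend to zero.  The vector [u] itself tends to the component of [xi] in
    the kernel, but there [|xi - u| <= |xi|] is enough, since [|xi|^2] enters the
    form with a positive coefficient ([witness_form_ge0]).

    The functional.  Numbers [mu i j] prescribed for [x'^i x^j] always extend to a
    linear functional ([table_functional]).  Ask for [F 1 = F N = 1],
    [F (N^2) = 1 + eta], [F (N^3) = 10], [F (v' v) = 3/2] and [F (x^4) = 0].  The
    element above then has the value [k eta + 1/8 + 3/4 - (1 + eta)], which is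
    negative for small [eta] ([witness_value_moment]).  In a well-behaved
    representation [F (N^2)] close to [(F N)^2 = 1] would force [N] to be close
    to 1 on the cyclic vector, which contradicts the values of [F (v' v)]
    and [F (x^4)]; squares in the algebra do not detect this, as the Gram
    matrix of the monomials of degree at most 3 is positive definite
    ([coercive_base]).  All other moments vanish, except for those of [x'^n x^n]
    with [n >= 4]: chosen one after the other, each large with respect to the
    previous ones, they keep all Gram matrices positive definite
    ([coercive_step]). *)

Set Implicit Arguments.
Unset Strict Implicit.
Unset Printing Implicit Defensive.

Import Order.TTheory GRing.Theory Num.Theory.

Local Open Scope classical_set_scope.
Local Open Scope ring_scope.
Local Open Scope complex_scope.

(** * The real inner product of a complex Hilbert space *)

Section RealInner.
Variables (R : realType) (H : hilbertSpace R).
Implicit Types (u v w : H) (a : R).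

(** The real part of the inner product suffices for all estimates, and turns them
    into estimates between real numbers. *)
Definition rinner v w : R := complex.Re (inner H v w).
Definition sqnorm v : R := rinner v v.

Lemma inner_conj v w : inner H v w = Num.conj (inner H w v).
Proof. by rewrite (@hermitian_subproof _ _ _ _ (inner H)) expr0 mul1r. Qed.

Lemma Re_conj (z : R[i]) : complex.Re (Num.conj z) = complex.Re z.
Proof. by case: z. Qed.

Lemma Re_mulr a (z : R[i]) : complex.Re (a%:C * z) = a * complex.Re z.
Proof. by case: z => x y /=; rewrite mul0r subr0. Qed.

Lemma ReD (y z : R[i]) : complex.Re (y + z) = complex.Re y + complex.Re z.
Proof. by case: y z => ? ? []. Qed.

Lemma ReN (z : R[i]) : complex.Re (- z) = - complex.Re z.
Proof. by case: z. Qed.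

Lemma rinnerC v w : rinner v w = rinner w v.
Proof. by rewrite /rinner inner_conj Re_conj. Qed.

Lemma rinnerDl u v w : rinner (u + v) w = rinner u w + rinner v w.
Proof. by rewrite /rinner linearDl ReD. Qed.

Lemma rinnerNl u v : rinner (- u) v = - rinner u v.
Proof. by rewrite /rinner linearNl ReN. Qed.

Lemma rinnerZl a u v : rinner (a%:C *: u) v = a * rinner u v.
Proof. by rewrite /rinner linearZl_LR /= Re_mulr. Qed.

Lemma rinnerDr u v w : rinner u (v + w) = rinner u v + rinner u w.
Proof. by rewrite rinnerC rinnerDl !(rinnerC u). Qed.

Lemma rinnerNr u v : rinner u (- v) = - rinner u v.
Proof. by rewrite rinnerC rinnerNl rinnerC. Qed.

Lemma rinnerZr a u v : rinner u (a%:C *: v) = a * rinner u v.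
Proof. by rewrite rinnerC rinnerZl rinnerC. Qed.

Lemma rinner0l u : rinner 0 u = 0.
Proof. by rewrite /rinner linear0l. Qed.

Definition rinnerE := (rinnerDl, rinnerDr, rinnerNl, rinnerNr, rinnerZl, rinnerZr).

Lemma inner_sqnorm v : inner H v v = (sqnorm v)%:C.
Proof.
rewrite /sqnorm /rinner; have : Num.conj (inner H v v) = inner H v v.
  by rewrite -inner_conj.
case: (inner H v v) => x y [] y0.
by congr (_ +i* _); rewrite /=; lra.
Qed.

Lemma sqnorm_ge0 v : 0 <= sqnorm v.
Proof. by rewrite -lecR -inner_sqnorm -sqr_norm_inner exprn_ge0. Qed.

Lemma norm_sqnorm v : `|v| = (Num.sqrt (sqnorm v))%:C.
Proof.
apply/eqP; rewrite -(@eqrXn2 _ 2) // ?lecR ?sqrtr_ge0 //.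
by rewrite sqr_norm_inner inner_sqnorm -rmorphXn /= sqr_sqrtr ?sqnorm_ge0.
Qed.

Lemma sqnorm_eq0 v : sqnorm v = 0 -> v = 0.
Proof. by move=> v0; apply/eqP; rewrite -normr_eq0 norm_sqnorm v0 sqrtr0. Qed.

Lemma sqnormN v : sqnorm (- v) = sqnorm v.
Proof. by rewrite /sqnorm !rinnerE opprK. Qed.

Lemma sqnormD v w : sqnorm (v + w) = sqnorm v + 2 * rinner v w + sqnorm w.
Proof. by rewrite /sqnorm !rinnerE (rinnerC w v); ring. Qed.

Lemma sqnormB v w : sqnorm (v - w) = sqnorm v - 2 * rinner v w + sqnorm w.
Proof. by rewrite sqnormD sqnormN rinnerNr; ring. Qed.

Lemma sqnormZ a v : sqnorm (a%:C *: v) = a ^+ 2 * sqnorm v.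
Proof. by rewrite /sqnorm !rinnerE; ring. Qed.

Lemma sqnormD_le v w : sqnorm (v + w) <= 2 * sqnorm v + 2 * sqnorm w.
Proof. by have := sqnorm_ge0 (v - w); rewrite sqnormB sqnormD; lra. Qed.

Lemma rinner_young a v w : 0 < a -> 2 * rinner v w <= a * sqnorm v + a^-1 * sqnorm w.
Proof.
move=> a0; have := sqnorm_ge0 (a%:C *: v - w); rewrite sqnormB sqnormZ rinnerZl => h.
have : 0 <= a^-1 * (a ^+ 2 * sqnorm v - 2 * (a * rinner v w) + sqnorm w).
  by rewrite mulr_ge0 // invr_ge0 ltW.
suff -> : a^-1 * (a ^+ 2 * sqnorm v - 2 * (a * rinner v w) + sqnorm w) =
  a * sqnorm v - 2 * rinner v w + a^-1 * sqnorm w by lra.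
by field; rewrite gt_eqF.
Qed.

Lemma rinner_cauchy_schwarz v w : rinner v w ^+ 2 <= sqnorm v * sqnorm w.
Proof.
have [w0|w0] := eqVneq (sqnorm w) 0.
  by rewrite (sqnorm_eq0 w0) rinnerC rinner0l /sqnorm rinner0l expr0n mulr0.
have wp : 0 < sqnorm w by rewrite lt_neqAle eq_sym w0 sqnorm_ge0.
have := sqnorm_ge0 (v - (rinner v w / sqnorm w)%:C *: w).
rewrite sqnormB sqnormZ rinnerZr.
have -> : sqnorm v - 2 * (rinner v w / sqnorm w * rinner v w) + (rinner v w / sqnorm w) ^+ 2 * sqnorm w
  = (sqnorm v * sqnorm w - rinner v w ^+ 2) / sqnorm w by field.
by rewrite pmulr_lge0 ?invr_gt0 // subr_ge0.
Qed.

Lemma op_dom0 (X : linear_operator H) : op_dom X 0.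
Proof. by case: (op_dom_subspace X). Qed.

Lemma op_domP (X : linear_operator H) (c : R[i]) f g :
  op_dom X f -> op_dom X g -> op_dom X (c *: f + g).
Proof. by case: (op_dom_subspace X) => _; apply. Qed.

Lemma op_domZ (X : linear_operator H) (c : R[i]) f :
  op_dom X f -> op_dom X (c *: f).
Proof. by move=> Df; rewrite -[_ *: _]addr0; apply: op_domP => //; exact: op_dom0. Qed.

Lemma op_domD (X : linear_operator H) f g :
  op_dom X f -> op_dom X g -> op_dom X (f + g).
Proof. by move=> Df Dg; rewrite -[f]scale1r; apply: op_domP. Qed.

Lemma op_domB (X : linear_operator H) f g :
  op_dom X f -> op_dom X g -> op_dom X (f - g).
Proof. by move=> Df Dg; rewrite -scaleN1r addrC; apply: op_domP. Qed.

Lemma op_fun0 (X : linear_operator H) : X 0 = 0.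
Proof.
have := op_fun_linear 1 (op_dom0 X) (op_dom0 X).
rewrite !scale1r addr0 => /eqP; rewrite -subr_eq0 opprD addrA subrr add0r oppr_eq0.
by move/eqP.
Qed.

Lemma op_funZ (X : linear_operator H) (c : R[i]) f :
  op_dom X f -> X (c *: f) = c *: X f.
Proof.
by move=> Df; rewrite -[_ *: f]addr0 op_fun_linear ?op_fun0 ?addr0 //; exact: op_dom0.
Qed.

Lemma op_funD (X : linear_operator H) f g :
  op_dom X f -> op_dom X g -> X (f + g) = X f + X g.
Proof. by move=> Df Dg; rewrite -[f]scale1r op_fun_linear // !scale1r. Qed.

(** Real parts lose nothing: the imaginary part of the identity at [f] is its
    real part at ['i f]. *)
Lemma adjoint_graph_rinner (X : linear_operator H) g h :
  (forall f, op_dom X f -> rinner (X f) g = rinner f h) -> adjoint_graph X g h.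
Proof.
move=> Xgh f Df; have Dif := op_domZ 'i%C Df.
have := Xgh _ Dif; rewrite op_funZ // /rinner !linearZl_LR /=.
have := Xgh _ Df; rewrite /rinner.
case: (inner H (X f) g) => a b; case: (inner H f h) => c d /=.
rewrite !mul0r !mul1r !sub0r => -> /eqP; rewrite eqr_opp => /eqP ->.
by [].
Qed.

(** Norm convergence, with real tolerances although the norm is complex valued. *)
Definition sqnorm_cvg (u : nat -> H) (l : H) :=
  forall e : R, 0 < e -> exists N, forall n, (N <= n)%N -> sqnorm (u n - l) <= e.

Lemma hilbert_complete (u : nat -> H) :
  (forall e : R, 0 < e -> exists N, forall m n, (N <= m)%N -> (N <= n)%N ->
     sqnorm (u m - u n) <= e) ->
  exists l, sqnorm_cvg u l.
Proof.
move=> cu.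
have /cauchy_cvgP/cvg_ex [l ul] : cauchy (u @ \oo).
  apply/cauchy_ballP => -[e e'] /= eps0; near_simpl.
  move: eps0; rewrite ltcE /= => /andP[/eqP -> e0].
  have [N uN] := cu (e ^+ 2 / 4) ltac:(by rewrite divr_gt0 ?exprn_gt0 ?ltr0n).
  exists ([set n | (N <= n)%N], [set n | (N <= n)%N]).
    by split; exists N.
  move=> [m n] /= [Nm Nn]; rewrite -ball_normE /= norm_sqnorm ltcR.
  rewrite -(ger0_norm (ltW e0)) -sqrtr_sqr ltr_sqrt ?exprn_gt0 //.
  by apply: le_lt_trans (uN _ _ Nm Nn) _; nra.
exists l => e e0.
have /cvgrPdist_le /(_ (Num.sqrt e)%:C) : u @ \oo --> l by exact: ul.
rewrite ltcR sqrtr_gt0 => /(_ e0) [N _ uN]; exists N => n Nn.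
have := uN n Nn; rewrite norm_sqnorm lecR -sqnormN opprB => h.
by rewrite -(ler_sqrt _ (ltW e0)).
Unshelve. all: by end_near.
Qed.

End RealInner.

(** * Resolvents of closed operators by energy minimisation *)

Section Resolvent.
Variables (R : realType) (H : hilbertSpace R).
Implicit Types (u v w : H).

Lemma op_funB (X : linear_operator H) f g :
  op_dom X f -> op_dom X g -> X (f - g) = X f - X g.
Proof.
move=> Df Dg; rewrite -scaleN1r addrC op_fun_linear // scaleN1r addrC //.
Qed.

Definition closed_op (A : linear_operator H) :=
  forall (u : nat -> H) l y, (forall n, op_dom A (u n)) ->
    sqnorm_cvg u l -> sqnorm_cvg (A \o u) y -> op_dom A l /\ A l = y.

Lemma invn_small (e : R) : 0 < e -> exists N, forall n, (N <= n)%N -> n.+1%:R^-1 <= e.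
Proof.
move=> e0; exists (Num.truncn e^-1) => n Nn.
rewrite -[e]invrK lef_pV2 ?posrE ?invr_gt0 //.
have /ltW/le_trans -> // : e^-1 < (Num.truncn e^-1).+1%:R.
  by apply: truncnS_gt.
by rewrite ler_nat ltnS.
Qed.

Lemma le0_of_small (a C : R) : 0 <= C ->
  (forall e : R, 0 < e -> e <= 1 -> a <= C * e) -> a <= 0.
Proof.
move=> C0 h; have [//|a0] := leP a 0.
have C1 : 0 < C + a + 1 by lra.
have := h (a / (C + a + 1)) (divr_gt0 a0 C1).
by rewrite ler_pdivrMr // mulrA ler_pdivlMr // => /(_ ltac:(lra)); nra.
Qed.

(** [u] minimises [J u = |xi - u|^2 + s |A u|^2] over the domain of [A].  By the
    parallelogram law a minimising sequence is Cauchy for the graph norm, so it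
    converges in the domain of the closed operator [A]; the identity is the
    vanishing of the derivative [G] of [J] at the limit. *)
Lemma resolvent (A : linear_operator H) (s : R) (xi : H) :
  closed_op A -> 0 < s ->
  exists u, op_dom A u /\
    forall w, op_dom A w -> rinner u w + s * rinner (A u) (A w) = rinner xi w.
Proof.
move=> clA s0.
pose J u : R := sqnorm (xi - u) + s * sqnorm (A u).
have J0 u : 0 <= J u by rewrite addr_ge0 ?sqnorm_ge0 // mulr_ge0 ?sqnorm_ge0 // ltW.
pose E : set R := [set J u | u in op_dom A].
have hE : has_inf E.
  split; first by exists (J 0), 0 => //; exact: op_dom0.
  by exists 0 => _ [u _ <-].
pose m := inf E.
have mJ u : op_dom A u -> m <= J u by move=> Du; apply: ge_inf; [case: hE|exists u].
have /choice[u uP] n : exists u, op_dom A u /\ J u <= m + n.+1%:R^-1.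
  have [] := @inf_adherent _ E n.+1%:R^-1 _ hE; first by rewrite invr_gt0.
  by move=> _ [u Du <-] /ltW Ju; exists u.
have uD n : op_dom A (u n) by case: (uP n).
have uJ n : J (u n) <= m + n.+1%:R^-1 by case: (uP n).
pose Q v := sqnorm v + s * sqnorm (A v).
have QE v : 0 <= sqnorm v /\ 0 <= s * sqnorm (A v).
  by rewrite sqnorm_ge0 mulr_ge0 ?sqnorm_ge0 // ltW.
pose G v w : R := - rinner (xi - v) w + s * rinner (A v) (A w).
have JD v w (t : R) : op_dom A v -> op_dom A w ->
    J (t%:C *: w + v) = J v + 2 * t * G v w + t ^+ 2 * Q w.
  move=> Dv Dw; rewrite /J op_fun_linear // opprD addrCA.
  rewrite (sqnormD (- _)) sqnormN sqnormZ.
  rewrite (sqnormD (_ *: A w)) sqnormZ !rinnerE /G /Q !rinnerE.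
  by rewrite (rinnerC w xi) (rinnerC w v) (rinnerC (A w)); ring.
(* parallelogram law, through the midpoint of [u i] and [u j] *)
have QB i j : Q (u i - u j) <= 2 * (i.+1%:R^-1 + j.+1%:R^-1).
  have Dij : op_dom A (u i - u j) by exact: op_domB.
  have e1 := JD (u j) (u i - u j) 1 (uD j) Dij.
  have e2 := JD (u j) (u i - u j) 2^-1 (uD j) Dij.
  have := mJ _ (op_domP (2^-1)%:C Dij (uD j)).
  move: e1; rewrite rmorph1 scale1r subrK => e1.
  have := uJ i; have := uJ j; rewrite e2; rewrite e1.
  move: (J _) (G _ _) (Q _) (i.+1%:R^-1) (j.+1%:R^-1) => b c d x y.
 lra.
have cu (e : R) : 0 < e -> exists N, forall i j, (N <= i)%N -> (N <= j)%N ->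
    Q (u i - u j) <= e.
  move=> e0; have [N NP] := @invn_small (e / 4) ltac:(lra).
  exists N => i j Ni Nj; have := NP i Ni; have := NP j Nj; have := QB i j.
  by move: (i.+1%:R^-1) (j.+1%:R^-1) => x y *; lra.
have [l ul] : exists l, sqnorm_cvg u l.
  apply: hilbert_complete => e e0; have [N NP] := cu e e0.
  exists N => i j Ni Nj; have := NP i j Ni Nj; rewrite /Q.
  have [] := QE (u i - u j); lra.
have [y uy] : exists y, sqnorm_cvg (A \o u) y.
  apply: hilbert_complete => e e0; have [N NP] := cu (s * e) (mulr_gt0 s0 e0).
  exists N => i j Ni Nj; have := NP i j Ni Nj; rewrite /Q op_funB //.
  rewrite /= -(ler_pM2l s0 (sqnorm (A _ - _))).
  by have := sqnorm_ge0 (u i - u j); lra.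
have [Dl Al] := clA _ _ _ uD ul uy.
exists l; split=> // w Dw.
suff : G l w = 0 by rewrite /G !rinnerE; lra.
apply/eqP; rewrite -sqrf_eq0 eq_le sqr_ge0 andbT.
(* [u n] is optimal up to [1 / (n + 1)]; compare it with the best step along [w] *)
have Gn n : G (u n) w ^+ 2 <= (Q w + 1) * n.+1%:R^-1.
  have Q1 : 0 < Q w + 1 by have [? ?] := QE w; rewrite /Q; lra.
  have := mJ _ (op_domP (- (G (u n) w / (Q w + 1)))%:C Dw (uD n)).
  rewrite JD // [X in _ -> _ <= X]mulrC -ler_pdivrMr //; have := uJ n.
  set g := G (u n) w; set p := g / (Q w + 1); set z := n.+1%:R^-1.
  have e1 : p * g = g ^+ 2 / (Q w + 1) by rewrite /p; ring.
  have e2 : p ^+ 2 * (Q w + 1) = g ^+ 2 / (Q w + 1).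
    by rewrite /p /g; field; rewrite gt_eqF.
  have := sqr_ge0 p; move: e1 e2; move: (g ^+ 2 / _) (J _) => c j; nra.
apply: (@le0_of_small _ (3 * (Q w + 1) + 3 * sqnorm w + 3 * s ^+ 2 * sqnorm (A w))).
  have [? ?] := QE w; have := sqnorm_ge0 w; have := sqnorm_ge0 (A w); have := sqr_ge0 s.
  rewrite /Q; nra.
move=> e e0 _; have [N1 NP1] := invn_small e0; have [N2 NP2] := ul e e0.
have [N3 NP3] := uy e e0.
pose n := maxn N1 (maxn N2 N3).
have n1 := NP1 n (leq_maxl _ _).
have n2 := NP2 n (leq_trans (leq_maxl _ _) (leq_maxr _ _)).
have n3 := NP3 n (leq_trans (leq_maxr _ _) (leq_maxr _ _)).
have -> : G l w = G (u n) w - rinner (u n - l) w - s * rinner (A (u n) - y) (A w).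
  by rewrite /G Al !rinnerE; ring.
have c1 := rinner_cauchy_schwarz (u n - l) w.
have c2 := rinner_cauchy_schwarz (A (u n) - y) (A w).
have d1 := ler_wpM2r (sqnorm_ge0 w) n2; have d2 := ler_wpM2r (sqnorm_ge0 (A w)) n3.
have d2' := ler_wpM2l (sqr_ge0 s) (le_trans c2 d2).
have d3 : (Q w + 1) * n.+1%:R^-1 <= (Q w + 1) * e.
  by apply: ler_wpM2l => //; have [? ?] := QE w; rewrite /Q; lra.
have := Gn n.
move: (G _ _) (rinner (u n - l) w) d2' c1 => a b d2' c1.
move: (rinner (A (u n) - y) (A w)) d2' c2 => c d2' c2 Gna.
have := sqr_ge0 (a + b); have := sqr_ge0 (a + s * c); have := sqr_ge0 (b - s * c).
rewrite -exprMn in d2'.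
move: (s * c) d2' => z d2'.
have : a ^+ 2 <= (Q w + 1) * e by exact: le_trans Gna d3.
have : b ^+ 2 <= e * sqnorm w by exact: le_trans c1 d1.
move: d2'; move: (Q w) (sqnorm w) (sqnorm (A w)) => X Y Z; nra.
Qed.

End Resolvent.

(** * Adjoints and smooth vectors of q-normal operators *)

Section Dense.
Variables (R : realType) (H : hilbertSpace R).

Lemma dense_ortho (D : set H) (h : H) :
  dense D -> (forall f, D f -> inner H f h = 0) -> h = 0.
Proof.
move=> dD oh; apply/eqP/negPn/negP => h0.
have hn : 0 < `|h| by rewrite normr_gt0.
have [f [hf Df]] := dD (ball h `|h|) (ex_intro _ h (ballxx h hn)) (ball_open h _).
move: hf; rewrite -ball_normE /= !norm_sqnorm ltcR.
have := oh _ Df => /(congr1 (@complex.Re R)); rewrite -[LHS]/(rinner f h) /= => fh.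
rewrite ltr_sqrt; last first.
  by rewrite lt_neqAle sqnorm_ge0 andbT eq_sym; apply: contra h0 => /eqP/sqnorm_eq0 ->.
by rewrite sqnormB rinnerC fh; have := sqnorm_ge0 f; lra.
Qed.

Variable X : linear_operator H.
Hypothesis dX : densely_defined X.

Lemma adjoint_graph_inj g h h' :
  adjoint_graph X g h -> adjoint_graph X g h' -> h = h'.
Proof.
move=> gh gh'; apply/eqP; rewrite -subr_eq0; apply/eqP.
apply: (dense_ortho dX) => f Df; rewrite linearBr; apply/eqP.
by rewrite subr_eq0 -[X in X == _](gh f Df) -[X in _ == X](gh' f Df).
Qed.

Lemma adjointP g : adjoint_dom X g -> adjoint_graph X g (adjoint X g).
Proof.
by move=> [h gh]; apply: (@xgetPex _ 0 [set h | adjoint_graph X g h]); exists h. Qed.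

Lemma adjointE g h : adjoint_graph X g h -> adjoint X g = h.
Proof.
by move=> gh; apply: (@adjoint_graph_inj g) => //; apply: adjointP; exists h.
Qed.

Lemma adjoint_graph_linear (c : R[i]) f g f' g' :
  adjoint_graph X f f' -> adjoint_graph X g g' ->
  adjoint_graph X (c *: f + g) (c *: f' + g').
Proof.
move=> ff' gg' u Du; rewrite !linearDr /= gg' //; congr (_ + _).
by rewrite !linearZr_LR /= ff'.
Qed.

Lemma adjoint_dom_subspace : is_subspace (adjoint_dom X).
Proof.
split; first by exists 0 => f _; rewrite !linear0r.
move=> c f g [f' ff'] [g' gg']; exists (c *: f' + g').
exact: adjoint_graph_linear.
Qed.

Lemma adjoint_linear (c : R[i]) f g : adjoint_dom X f -> adjoint_dom X g ->
  adjoint X (c *: f + g) = c *: adjoint X f + adjoint X g.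
Proof.
by move=> Df Dg; apply: adjointE; apply: adjoint_graph_linear; exact: adjointP.
Qed.

Definition adjoint_op : linear_operator H :=
  LinearOperator adjoint_dom_subspace adjoint_linear.

Lemma adjoint_rinner f g : op_dom X f -> adjoint_dom X g ->
  rinner (X f) g = rinner f (adjoint X g).
Proof. by move=> Df Dg; rewrite /rinner (adjointP Dg). Qed.

Lemma sqnorm_cvg_rinner (u : nat -> H) (l w : H) (e : R) : sqnorm_cvg u l -> 0 < e ->
  exists N, forall n, (N <= n)%N -> (rinner w (u n - l)) ^+ 2 <= sqnorm w * e.
Proof.
move=> ul e0; have [N NP] := ul e e0; exists N => n Nn.
apply: le_trans (rinner_cauchy_schwarz _ _) _.
by apply: ler_wpM2l (NP _ Nn); exact: sqnorm_ge0.
Qed.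

Lemma adjoint_closed : closed_op adjoint_op.
Proof.
move=> u l y uD ul uy.
suff ly : adjoint_graph X l y by split; [exists y | exact: adjointE].
apply: adjoint_graph_rinner => f Df; apply/eqP; rewrite -subr_eq0 -sqrf_eq0.
rewrite eq_le sqr_ge0 andbT.
apply: (@le0_of_small R _ (2 * sqnorm (X f) + 2 * sqnorm f)).
  by have := sqnorm_ge0 (X f); have := sqnorm_ge0 f; lra.
move=> e e0 _; have [N1 P1] := sqnorm_cvg_rinner (X f) ul e0.
have [N2 P2] := sqnorm_cvg_rinner f uy e0.
pose n := maxn N1 N2.
have := P1 n (leq_maxl _ _); have := P2 n (leq_maxr _ _).
rewrite /= !rinnerE adjoint_rinner; [|exact: Df|exact: uD].
move: (rinner _ _) (rinner _ _) (rinner _ _) => a b c.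
have := sqr_ge0 ((c - b) + (c - a)); nra.
Qed.

End Dense.

Section QNormal.
Variables (R : realType) (H : hilbertSpace R) (q : R) (X : linear_operator H).
Hypotheses (q_gt0 : 0 < q) (qX : q_normal q X).

Let dX : densely_defined X. Proof. by case: qX. Qed.
Let domX : op_dom X = adjoint_dom X. Proof. by case: qX. Qed.
Notation "X ^#" := (adjoint X) (at level 2).

Let sqnorm_adjoint f : op_dom X f -> sqnorm (X^# f) = q * sqnorm (X f).
Proof.
move=> Df; case: qX => _ _ /(_ f Df) /(congr1 (fun z => z ^+ 2)).
rewrite exprMn !sqr_norm_inner !inner_sqnorm -rmorphXn /= sqr_sqrtr ?ltW //.
by rewrite -rmorphM /= => /complexI.
Qed.

Let adj_op := adjoint_op dX.

(** Polarisation of the equality of norms defining q-normality. *)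
Lemma rinner_adjoint2 f g : op_dom X f -> op_dom X g ->
  rinner (X^# f) (X^# g) = q * rinner (X f) (X g).
Proof.
move=> Df Dg.
have e : sqnorm (X^# (f + g)) = sqnorm (X^# f + X^# g).
  by rewrite -[X^#]/(op_fun adj_op) op_funD //= -domX.
have := sqnorm_adjoint (op_domD Df Dg); rewrite e op_funD // !sqnormD !sqnorm_adjoint //.
lra.
Qed.

(** Weak form of [u + s X X^# u = xi]: it asks nothing of the domain of [X X^#]. *)
Definition weak_sol (s : R) (u xi : H) := op_dom X u /\
  forall w, op_dom X w -> rinner u w + s * rinner (X^# u) (X^# w) = rinner xi w.

(** The form [s <X^# u, X^# w>] is closed because adjoints are, and the domains of
    [X] and of its adjoint agree. *)
Lemma weak_sol_ex (s : R) (xi : H) : 0 < s -> exists u, weak_sol s u xi.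
Proof.
move=> s0; have [u [Du uP]] := resolvent xi (@adjoint_closed _ _ _ dX) s0.
by exists u; split=> [|w Dw]; [rewrite domX|apply: uP; rewrite /= -domX].
Qed.

(** By [rinner_adjoint2] the weak equation also reads
    [s q <X u, X w> = <xi - u, w>], which says that [X u] lies in the domain of the
    adjoint, that is, of [X]. *)
Lemma weak_sol_strong (s : R) (u xi : H) : 0 < s -> weak_sol s u xi ->
  op_dom X (X u) /\ xi - u = (s * q)%:C *: X^# (X u).
Proof.
move=> s0 [Du uP]; have sq0 : s * q != 0 by rewrite gt_eqF // mulr_gt0.
have g : adjoint_graph X (X u) ((s * q)^-1%:C *: (xi - u)).
  apply: adjoint_graph_rinner => w Dw; have := uP w Dw.
  rewrite rinner_adjoint2 // mulrA !rinnerE (rinnerC w xi) (rinnerC w u) => <-.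
  by rewrite (rinnerC (X w)); field; rewrite !gt_eqF.
split; first by rewrite domX; exists ((s * q)^-1%:C *: (xi - u)).
by rewrite (adjointE dX g) scalerA -rmorphM /= divff // scale1r.
Qed.

(** From [X X X^# = q X X^# X]: applying [X] to a solution for [s] solves the
    problem for [q s]. *)
Lemma weak_solX (s : R) (u xi : H) : 0 < s -> weak_sol s u xi -> op_dom X xi ->
  weak_sol (q * s) (X u) (X xi).
Proof.
move=> s0 us Dxi; have [DXu e] := weak_sol_strong s0 us.
case: (us) => Du _; split=> // w Dw.
have sq0 : s * q != 0 by rewrite gt_eqF // mulr_gt0.
have e2 : X^# (X u) = (s * q)^-1%:C *: (xi - u).
  by rewrite e scalerA -rmorphM /= mulVf // scale1r.
have D2 : op_dom X (X^# (X u)) by rewrite e2; apply/op_domZ/op_domB.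
rewrite -(adjoint_rinner D2); last by rewrite -domX.
rewrite e2 op_funZ; last exact: op_domB.
by rewrite op_funB // !rinnerE; field; rewrite !gt_eqF.
Qed.

(** Resolvents gain regularity: by [weak_solX] the claim for [u] follows from the
    one for [X u], whose datum [X xi] has one derivative less. *)
Lemma weak_sol_pow (n : nat) (s : R) (u xi : H) : 0 < s -> weak_sol s u xi ->
  pow_dom X n xi -> pow_dom X n.+1 u.
Proof.
elim: n s u xi => [|n IH] s u xi s0 us; first by case: us => Du _ _; split.
move=> [Dxi Dn]; split; first by case: us.
apply: (IH (q * s) _ (X xi)) => //; first by rewrite mulr_gt0.
exact: weak_solX.
Qed.

Lemma weak_sol_smooth (s : R) (u xi : H) : 0 < s -> weak_sol s u xi ->
  smooth_dom X xi -> smooth_dom X u.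
Proof.
move=> s0 us Dxi [//|n] _; apply: (weak_sol_pow s0 us).
by case: n => [//|n]; exact: (Dxi n.+1).
Qed.

(** Test the equation with [w] itself: the datum contributes
    [<X xi, w> = <xi, X^# w>], which the energy [s |X^# w|^2] absorbs. *)
Lemma weak_sol_small (s : R) (w xi : H) : 0 < s -> op_dom X xi -> weak_sol s w (X xi) ->
  sqnorm w <= sqnorm xi / s.
Proof.
move=> s0 Dxi [Dw wP]; have := wP w Dw; rewrite -!/(sqnorm _) adjoint_rinner // -?domX //.
have := rinner_young xi (X^# w) (_ : 0 < s^-1); rewrite invr_gt0 => /(_ s0).
rewrite invrK mulrC; have := sqnorm_ge0 (X^# w); have := sqnorm_ge0 xi.
have : 0 <= s * sqnorm (X^# w) by rewrite mulr_ge0 ?sqnorm_ge0 ?ltW.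
have : 0 <= sqnorm xi / s by rewrite divr_ge0 ?sqnorm_ge0 ?ltW.
lra.
Qed.

Lemma weak_sol_contract (s : R) (u xi : H) : 0 < s -> weak_sol s u xi ->
  sqnorm (xi - u) <= sqnorm xi.
Proof.
move=> s0 [Du uP]; have := uP u Du; rewrite -!/(sqnorm _) sqnormB.
have := sqnorm_ge0 u.
have : 0 <= s * sqnorm (X^# u) by rewrite mulr_ge0 ?sqnorm_ge0 ?ltW.
lra.
Qed.

End QNormal.

(** * A form that is nonnegative along a well-behaved representation *)

(** Only the algebra matters here: [D] is invariant under two formally
    adjoint maps [x] and [y] with [x y = q y x]. *)
Section Core.
Variables (R : realType) (H : hilbertSpace R) (q : R) (D : set H) (x y : H -> H).
Hypothesis q_gt0 : 0 < q.
Hypotheses (DD : forall f g, D f -> D g -> D (f + g))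
           (DZ : forall (a : R) f, D f -> D (a%:C *: f)).
Hypotheses (Dx : forall f, D f -> D (x f)) (Dy : forall f, D f -> D (y f)).
Hypotheses (xD : forall f g, D f -> D g -> x (f + g) = x f + x g)
           (yD : forall f g, D f -> D g -> y (f + g) = y f + y g).
Hypotheses (xZ : forall (a : R) f, D f -> x (a%:C *: f) = a%:C *: x f)
           (yZ : forall (a : R) f, D f -> y (a%:C *: f) = a%:C *: y f).
Hypothesis xy_adj : forall f g, D f -> D g -> rinner (x f) g = rinner f (y g).
Hypothesis xy_rel : forall f, D f -> x (y f) = q%:C *: y (x f).

Let qu : q != 0. Proof. by rewrite gt_eqF. Qed.

Hint Resolve DD DZ Dx Dy : core.

Lemma rinner_yy f g : D f -> D g -> rinner (y f) (y g) = q * rinner (x f) (x g).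
Proof.
move=> Df Dg; rewrite -xy_adj; auto; rewrite xy_rel //.
by rewrite rinnerZl rinnerC -xy_adj ?(rinnerC (x g)); auto.
Qed.

Lemma xyy f : D f -> x (y (y f)) = (q ^+ 2)%:C *: y (y (x f)).
Proof.
move=> Df; rewrite xy_rel; auto; rewrite xy_rel // yZ; auto.
by rewrite scalerA -rmorphM.
Qed.

Lemma xyyy f : D f -> x (y (y (y f))) = (q ^+ 3)%:C *: y (y (y (x f))).
Proof.
move=> Df; rewrite xy_rel; auto; rewrite xyy // yZ; auto.
by rewrite scalerA -rmorphM -exprS.
Qed.

Definition number_op f := y (x f).
(** The two summands of [vop] have equal norms, and so do those of [hop]: for
    [q = 1] and [x] multiplication by [r exp(i t)], up to a phase they are
    [r^3 (1 - exp(- 4 i t))] and [r^2 (1 - exp(- 4 i t))]. *)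
Definition vop f := x (number_op f) + (- q ^- 3)%:C *: y (y (y f)).
Definition hop f := x (x f) + (- q ^- 2)%:C *: y (y f).
(** [bcoef] makes [witness_form] an expression in [hop] along the range of [x]
    (see [hop_gh]); [2 * ccoef] bounds the cross terms in [rinner_hop_le], and
    [kcoef] is large enough to absorb them. *)
Definition bcoef : R := (q + q ^- 3) / 2.
Definition ccoef : R := (2 + q ^+ 2 + q ^- 2) / 2.
Definition kcoef : R := 4 * ccoef ^+ 2 + 1.
Definition witness_form f : R :=
  kcoef * sqnorm (number_op f - f) + sqnorm f / 8 + sqnorm (vop f) / 2 - sqnorm (number_op f)
  + bcoef * rinner (x (x f)) (y (y f)).

Lemma hopD f g : D f -> D g -> hop (f + g) = hop f + hop g.
Proof. by move=> Df Dg; rewrite /hop !(xD, yD); auto; rewrite scalerDr addrACA. Qed.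

Lemma number_op_x h : D h -> x (number_op h) = q%:C *: number_op (x h).
Proof. by move=> Dh; rewrite /number_op xy_rel; auto. Qed.

Lemma rinner_hop f g : D f -> D g ->
  rinner (hop f) (hop g) = 2 * rinner (x (x f)) (x (x g))
    - q ^- 2 * (rinner (x (x f)) (y (y g)) + rinner (y (y f)) (x (x g))).
Proof.
move=> Df Dg; rewrite /hop !rinnerE.
have -> : rinner (y (y f)) (y (y g)) = q ^+ 4 * rinner (x (x f)) (x (x g)).
  rewrite rinner_yy; auto; rewrite !xy_rel // !rinnerE rinner_yy; auto; ring.
by field.
Qed.

(** The form along the range of [x], where a factor [x^-1] is available: [h] plays
    the role of [x^-1 xi], and [h'] that of [x^-1 (N - 1) xi]. *)
Section Range.
Variable h : H.
Hypothesis Dh : D h.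
Let xi := x h.
Let g := (q^-1)%:C *: number_op h.
Let h' := g + (- 1)%:C *: h.
Let Dg : D g. Proof. by rewrite /g /number_op; auto. Qed.
Let Dh' : D h'. Proof. by rewrite /h'; auto. Qed.
Let Dxi : D xi. Proof. by rewrite /xi; auto. Qed.
Hint Resolve Dh Dg Dh' Dxi : core.

Let xg : x g = number_op xi.
Proof.
rewrite /g xZ; last by rewrite /number_op; auto.
by rewrite number_op_x // scalerA -rmorphM /= mulVf // scale1r.
Qed.

Let xh' : x h' = number_op xi - xi.
Proof. by rewrite /h' xD; auto; rewrite xg xZ; auto; rewrite rmorphN1 scaleN1r. Qed.

Let yyg : y (y g) = (q^-1)%:C *: y (y (y xi)).
Proof. by rewrite /g !yZ; rewrite /number_op; auto. Qed.

Let v_hop : vop xi = hop g.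
Proof.
rewrite /vop /hop xg yyg scalerA -rmorphM /=; congr (_ + _%:C *: _).
by field.
Qed.

Let rho := rinner (x (x xi)) (y (y xi)).

(** The coefficients [q] and [q^-3] of [bcoef] come from moving [x] past [y^3] in
    one cross term and from [y^2 g = q^-1 y^3 xi] in the other. *)
Let hop_gh : rinner (hop g) (hop h) = 2 * sqnorm (number_op xi) - 2 * bcoef * rho.
Proof.
have e1 : rinner (x (x g)) (x (x h)) = sqnorm (number_op xi).
  by rewrite xg xy_adj; auto; rewrite /number_op; auto.
have e2 : rinner (x (x g)) (y (y h)) = q ^+ 3 * rho.
  rewrite xy_adj; auto; rewrite xg rinnerC [number_op xi]/number_op -xy_adj; auto.
  by rewrite xyyy // rinnerZl rinnerC -xy_adj; auto.
have e3 : rinner (y (y g)) (x (x h)) = q^-1 * rho.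
  by rewrite yyg rinnerZl rinnerC -xy_adj; auto.
by rewrite rinner_hop // e1 e2 e3 /bcoef; field.
Qed.

(** In each of the products one factor moves across so that [h'] is hit by exactly
    one generator and [h] by three; all the resulting norms are multiples of
    those of [x h'] and [N xi]. *)
Let rinner_hop_le (a : R) : 0 < a ->
  - (2 + q ^+ 2 + q ^- 2) * (a * sqnorm (x h') + a^-1 * sqnorm (number_op xi)) <=
  2 * rinner (hop h') (hop h).
Proof.
move=> a0; rewrite rinner_hop //.
have e1 : rinner (x (x h')) (x (x h)) = rinner (x h') (number_op xi).
  by rewrite xy_adj; auto.
have e2 : rinner (x (x h')) (y (y h)) = rinner (x h') (y (y (y h))).
  by rewrite xy_adj; auto.
have e3 : rinner (y (y h')) (x (x h)) = rinner (y h') (x (x xi)).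
  by rewrite rinnerC -xy_adj ?(rinnerC (y h')); auto.
have n2 : sqnorm (y (y (y h))) = q ^+ 8 * sqnorm (number_op xi).
  rewrite /sqnorm; set T := rinner (number_op xi) _.
  rewrite rinner_yy; auto; rewrite xyy // !rinnerE rinner_yy; auto.
  by rewrite -/xi xy_rel // !rinnerE -/(number_op xi) -/T; ring.
have n3 : sqnorm (number_op xi) = q * sqnorm (x (x xi)).
  by rewrite /number_op /sqnorm rinner_yy; auto.
have n4 : sqnorm (y h') = q * sqnorm (x h') by rewrite /sqnorm rinner_yy.
(* the weights make the three bounds proportional to each other *)
have y1 := rinner_young (- x h') (number_op xi) a0.
have y2 := rinner_young (x h') (y (y (y h))) (mulr_gt0 (exprn_gt0 4 q_gt0) a0).
have y3 := rinner_young (y h') (x (x xi)) (divr_gt0 a0 q_gt0).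
move: y1 y2 y3; rewrite e1 e2 e3 n2 n4 sqnormN rinnerNl.
have -> : sqnorm (x (x xi)) = q^-1 * sqnorm (number_op xi) by rewrite n3 mulKf.
have p2 : 0 < q ^- 2 by rewrite invr_gt0 exprn_gt0.
move=> y1 /(ler_wpM2l (ltW p2)) y2 /(ler_wpM2l (ltW p2)) y3.
have f2 : q ^- 2 * (q ^+ 4 * a * sqnorm (x h') + (q ^+ 4 * a)^-1 * (q ^+ 8 * sqnorm (number_op xi)))
   = q ^+ 2 * (a * sqnorm (x h') + a^-1 * sqnorm (number_op xi)).
  by field; rewrite qu gt_eqF.
have f3 : q ^- 2 * (a / q * (q * sqnorm (x h')) + (a / q)^-1 * (q^-1 * sqnorm (number_op xi)))
   = q ^- 2 * (a * sqnorm (x h') + a^-1 * sqnorm (number_op xi)).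
  by field; rewrite qu gt_eqF.
move: y1 y2 y3; rewrite f2 f3; lra.
Qed.

Lemma witness_form_range : 0 <= witness_form xi.
Proof.
rewrite /witness_form /kcoef; set C := ccoef.
have Cq : 2 + q ^+ 2 + q ^- 2 = 2 * C by rewrite /C /ccoef; field.
have C1 : 1 <= C.
  have : 0 <= q ^- 2 by rewrite invr_ge0 exprn_ge0 ?ltW.
  have := sqr_ge0 q; rewrite /C /ccoef; lra.
rewrite v_hop -/rho -xh'.
have -> : hop g = hop h' + hop h.
  rewrite -hopD //; congr hop.
  by rewrite /h' -addrA rmorphN1 scaleN1r addNr addr0.
have := hop_gh.
have -> : hop g = hop h' + hop h.
  rewrite -hopD //; congr hop.
  by rewrite /h' -addrA rmorphN1 scaleN1r addNr addr0.
(* weight [8 C]: the part in [|xi|^2] is then exactly [1/8] *)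
have := @rinner_hop_le (8 * C) ltac:(lra); rewrite Cq.
rewrite sqnormD (rinnerDl (hop h')) -/(sqnorm (hop h)).
have := sqnorm_ge0 (hop h'); have := sqnorm_ge0 (x h'); have := sqnorm_ge0 xi.
have : sqnorm (number_op xi) <= 2 * sqnorm (x h') + 2 * sqnorm xi.
  by rewrite -[X in sqnorm X <= _](subrK xi) -xh'; exact: sqnormD_le.
have -> : - (2 * C) * (8 * C * sqnorm (x h') + (8 * C)^-1 * sqnorm (number_op xi)) =
   - 16 * C ^+ 2 * sqnorm (x h') - 4^-1 * sqnorm (number_op xi).
  by field; rewrite gt_eqF //; lra.
move: (rinner (hop h') _) (sqnorm (x h')) (sqnorm xi) (sqnorm (number_op xi)).
move: (sqnorm (hop h')) (sqnorm (hop h)) => U Wh V P S W.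
move: (C ^+ 2) => C2.
lra.
Qed.

End Range.

(** Polarisation vector: it expresses the term [Re <x^2 f, y^2 f>] of
    [witness_form] through square norms. *)
Definition wop f := x (x f) + y (y f).

Lemma xB f g : D f -> D g -> x (f + (-1)%:C *: g) = x f + (-1)%:C *: x g.
Proof. by move=> Df Dg; rewrite !(xD, xZ); auto. Qed.

Lemma number_opB f g : D f -> D g ->
  number_op (f + (-1)%:C *: g) = number_op f + (-1)%:C *: number_op g.
Proof. by move=> Df Dg; rewrite /number_op !(xD, yD, xZ, yZ); auto. Qed.

Lemma vopB f g : D f -> D g -> vop (f + (-1)%:C *: g) = vop f + (-1)%:C *: vop g.
Proof.
move=> Df Dg; rewrite /vop /number_op !(xD, yD, xZ, yZ); auto.
rewrite !scalerDr !scalerA addrACA; congr (_ + (_ + _ *: _)).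
by rewrite mulrC.
Qed.

Lemma wopB f g : D f -> D g -> wop (f + (-1)%:C *: g) = wop f + (-1)%:C *: wop g.
Proof.
by move=> Df Dg; rewrite /wop !(xD, yD, xZ, yZ); auto; rewrite scalerDr addrACA.
Qed.

Lemma sqnorm_xxy f : D f -> sqnorm (x (x f)) = q^-1 * sqnorm (number_op f).
Proof. by move=> Df; rewrite /number_op /sqnorm rinner_yy; auto; rewrite mulKf. Qed.

Lemma sqnorm_yy f : D f -> sqnorm (y (y f)) = q ^+ 3 * sqnorm (number_op f).
Proof.
move=> Df; rewrite /sqnorm rinner_yy; auto; rewrite xy_rel // !rinnerE -/(number_op f).
by rewrite /number_op; ring.
Qed.

Lemma witness_formE f : D f -> witness_form f =
  (kcoef + 1 / 8) * sqnorm f + (- 2 * kcoef) * sqnorm (x f)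
  + (kcoef - 1 - bcoef * (q^-1 + q ^+ 3) / 2) * sqnorm (number_op f)
  + 2^-1 * sqnorm (vop f) + bcoef / 2 * sqnorm (wop f).
Proof.
move=> Df; rewrite /witness_form sqnormB /wop sqnormD sqnorm_xxy // sqnorm_yy //.
rewrite [rinner (number_op f) f]rinnerC /number_op -xy_adj; auto; rewrite -/(sqnorm (x f)).
by field.
Qed.

Lemma sqnorm_close (c e M : R) (p d : H) : 0 <= M -> 0 < e -> e <= 1 ->
  sqnorm d <= M * e ^+ 2 ->
  c * sqnorm (p + (-1)%:C *: d) <= c * sqnorm p + `|c| * (sqnorm p + 2 * M) * e.
Proof.
move=> M0 e0 e1 dM.
have [y1 y2] : 2 * rinner p d <= (sqnorm p + M) * e /\ - (2 * rinner p d) <= (sqnorm p + M) * e.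
  have h : e^-1 * sqnorm d <= M * e.
    by rewrite mulrC ler_pdivrMr // -mulrA -expr2.
  have := rinner_young p d e0; have := rinner_young (- p) d e0.
  by rewrite sqnormN rinnerNl mulrDl (mulrC e); split; lra.
have d1 : sqnorm d <= M * e.
  by apply: le_trans dM _; apply: ler_wpM2l => //; rewrite expr2 ger_pMr.
rewrite sqnormD sqnormZ rinnerZr sqrrN expr1n mul1r.
have d0 := sqnorm_ge0 d.
have [a b] : sqnorm p + 2 * (-1 * rinner p d) + sqnorm d <= sqnorm p + (sqnorm p + 2 * M) * e /\
   sqnorm p - (sqnorm p + 2 * M) * e <= sqnorm p + 2 * (-1 * rinner p d) + sqnorm d.
  have := mulr_ge0 M0 (ltW e0); split; lra.
have [c0|c0] := leP 0 c.
  rewrite ger0_norm //; move: (ler_wpM2l c0 a); lra.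
rewrite ltr0_norm //; move: (ler_wnM2l (ltW c0) b); lra.
Qed.

Lemma sqnorm_vop_le f : D f -> sqnorm (vop f) <= 4 * q ^+ 3 * sqnorm (x (x (x f))).
Proof.
move=> Df; apply: le_trans (sqnormD_le _ _) _; rewrite sqnormZ.
have e1 : sqnorm (x (number_op f)) = q ^+ 3 * sqnorm (x (x (x f))).
  rewrite number_op_x; auto; rewrite sqnormZ /number_op.
  by rewrite {1}/sqnorm rinner_yy; auto; rewrite -/(sqnorm _); ring.
have e2 : sqnorm (y (y (y f))) = q ^+ 6 * sqnorm (x (number_op f)).
  rewrite {1}/sqnorm rinner_yy; auto; rewrite xyy // !rinnerE rinner_yy; auto.
  by rewrite -/(sqnorm _); ring.
rewrite e2 e1.
have -> : (- q ^- 3) ^+ 2 * (q ^+ 6 * (q ^+ 3 * sqnorm (x (x (x f))))) =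
  q ^+ 3 * sqnorm (x (x (x f))) by field.
lra.
Qed.

Lemma sqnorm_wop_le f : D f -> sqnorm (wop f) <= 2 * (1 + q ^+ 4) * sqnorm (x (x f)).
Proof.
move=> Df; apply: le_trans (sqnormD_le _ _) _.
have := sqnorm_xxy Df; have := sqnorm_yy Df.
have -> : sqnorm (number_op f) = q * sqnorm (x (x f)).
  by rewrite /number_op /sqnorm rinner_yy; auto.
move=> -> _; have -> : q ^+ 3 * (q * sqnorm (x (x f))) = q ^+ 4 * sqnorm (x (x f)) by ring.
lra.
Qed.

Lemma sum_le5 (a0 a1 a2 a3 a4 b0 b1 b2 b3 b4 d1 d2 d3 d4 : R) :
  a0 <= b0 -> a1 <= b1 + d1 -> a2 <= b2 + d2 -> a3 <= b3 + d3 -> a4 <= b4 + d4 ->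
  0 <= a0 + a1 + a2 + a3 + a4 ->
  - (b0 + b1 + b2 + b3 + b4) <= d1 + d2 + d3 + d4.
Proof. lra. Qed.

(** Nothing is asked of [u] itself, only of its images: if [f] has a component in
    the kernel of [x], it cannot be approximated in norm from the range of [x]. *)
Definition range_approx f (M e : R) := exists h u,
  [/\ D h, D u & f + (-1)%:C *: u = x h] /\
  [/\ sqnorm (x h) <= sqnorm f, sqnorm (x u) <= M * e ^+ 2,
      sqnorm (x (x u)) <= M * e ^+ 2 & sqnorm (x (x (x u))) <= M * e ^+ 2].

(** In [witness_formE] the coefficient of [|f|^2] is positive, so there it is
    enough that [|x h| <= |f|]; the other terms vary by [O(e)]. *)
Lemma witness_form_ge0 f (M : R) : D f -> 0 <= M ->
  (forall e, 0 < e -> e <= 1 -> range_approx f M e) -> 0 <= witness_form f.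
Proof.
move=> Df M0 app; rewrite -oppr_le0.
set c1 := - 2 * kcoef.
set c2 := kcoef - 1 - bcoef * (q^-1 + q ^+ 3) / 2.
set c4 := bcoef / 2.
pose B (c p m : R) := `|c| * (p + 2 * m).
have B0 c p m : 0 <= p -> 0 <= m -> 0 <= B c p m.
  by move=> p0 m0; rewrite mulr_ge0 // addr_ge0 // mulr_ge0.
pose C := B c1 (sqnorm (x f)) M + B c2 (sqnorm (number_op f)) (q * M)
  + B 2^-1 (sqnorm (vop f)) (4 * q ^+ 3 * M) + B c4 (sqnorm (wop f)) (2 * (1 + q ^+ 4) * M).
have q3 : 0 <= 4 * q ^+ 3 by rewrite mulr_ge0 // exprn_ge0 // ltW.
have q4 : 0 <= 2 * (1 + q ^+ 4) by rewrite mulr_ge0 // addr_ge0 // exprn_ge0 // ltW.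
have m2 : 0 <= q * M by rewrite mulr_ge0 // ltW.
have m3 := mulr_ge0 q3 M0; have m4 := mulr_ge0 q4 M0.
apply: (@le0_of_small R _ C) => [|e e0 e1].
  by rewrite !addr_ge0 // B0 // sqnorm_ge0.
have [h [u [[Dh Du fu] [hf u1 u2 u3]]]] := app e e0 e1.
have := witness_form_range Dh; rewrite -fu.
have Dfu : D (f + (-1)%:C *: u) by auto.
rewrite !witness_formE // vopB // wopB // number_opB // xB //.
have k1 := sqnorm_close c1 (x f) M0 e0 e1 u1.
have u2' : sqnorm (number_op u) <= q * M * e ^+ 2.
  rewrite /number_op /sqnorm rinner_yy; auto; rewrite -mulrA.
  by apply: ler_wpM2l => //; exact: ltW.
have k2 := sqnorm_close c2 (number_op f) m2 e0 e1 u2'.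
have u3' : sqnorm (vop u) <= 4 * q ^+ 3 * M * e ^+ 2.
  by apply: le_trans (sqnorm_vop_le Du) _; rewrite -[leRHS]mulrA; apply: ler_wpM2l.
have k3 := sqnorm_close 2^-1 (vop f) m3 e0 e1 u3'.
have u4' : sqnorm (wop u) <= 2 * (1 + q ^+ 4) * M * e ^+ 2.
  by apply: le_trans (sqnorm_wop_le Du) _; rewrite -[leRHS]mulrA; apply: ler_wpM2l.
have k4 := sqnorm_close c4 (wop f) m4 e0 e1 u4'.
have K0 : 0 <= kcoef + 1 / 8.
  by have := sqr_ge0 ccoef; rewrite /kcoef; lra.
have k0 : (kcoef + 1 / 8) * sqnorm (f + (-1)%:C *: u) <= (kcoef + 1 / 8) * sqnorm f.
  by apply: ler_wpM2l => //; rewrite fu.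
rewrite /C /B; move: k0 k1 k2 k3 k4; rewrite -/c1 -/c2 -/c4.
move=> k0 k1 k2 k3 k4 w0; rewrite !(mulrDl _ _ e); exact: (sum_le5 k0 k1 k2 k3 k4 w0).
Qed.

End Core.

(** * An inequality satisfied by q-moment functionals *)

Section Monomials.
Variables (R : realType) (q : R).
Notation x := (qplane_x q).
Notation xs := (qplane_star (qplane_x q)).

Definition mono (p : nat * nat) : qplane q := xs ^+ p.1 * x ^+ p.2.
(** [vpol] and [npol] act as [vop] and as [N - 1]; as [x N = q x' x^2], they are
    combinations of normally ordered monomials. *)
Definition vpol : qplane q := q%:C *: mono (1, 2)%N + (- q ^- 3)%:C *: mono (3, 0)%N.
Definition npol : qplane q := mono (1, 1)%N + (-1)%:C *: 1.

Lemma mono11 : mono (1, 1)%N = xs * x.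
Proof. by rewrite /mono !expr1. Qed.

Lemma mono12 : mono (1, 2)%N = xs * (x * x).
Proof. by rewrite /mono expr1 expr2. Qed.

Lemma mono30 : mono (3, 0)%N = xs * (xs * xs).
Proof. by rewrite /mono expr0 mulr1 !exprS expr0 mulr1. Qed.

Lemma mono04 : mono (0, 4)%N = x * (x * (x * x)).
Proof. by rewrite /mono expr0 mul1r !exprS expr0 mulr1. Qed.

Definition witness_value (F : qplane q -> R[i]) : R :=
  kcoef q * complex.Re (F (qplane_star npol * npol))
  + complex.Re (F 1) / 8
  + complex.Re (F (qplane_star vpol * vpol)) / 2
  - complex.Re (F (qplane_star (mono (1, 1)%N) * mono (1, 1)%N))
  + bcoef q * complex.Re (F (mono (0, 4)%N)).
End Monomials.

Section Rep.
Variables (R : realType) (q : R) (H : hilbertSpace R) (D : set H).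
Variables (pi : qplane q -> H -> H).
Hypotheses (q_gt0 : 0 < q) (rep : is_star_rep D pi) (wb : well_behaved D pi).
Let x := pi (qplane_x q).
Let y := pi (qplane_star (qplane_x q)).

Lemma rep_dom0 : D 0. Proof. by case: (star_rep_subspace rep). Qed.

Lemma rep_domD f g : D f -> D g -> D (f + g).
Proof.
by move=> Df Dg; case: (star_rep_subspace rep) => _ /(_ 1 f g Df Dg); rewrite scale1r.
Qed.

Lemma rep_domZ (c : R[i]) f : D f -> D (c *: f).
Proof.
move=> Df; case: (star_rep_subspace rep) => D0 /(_ c f 0 Df D0).
by rewrite addr0.
Qed.

Lemma rep_op0 a : pi a 0 = 0.
Proof.
have := star_rep_op_linear rep a 1 rep_dom0 rep_dom0.
rewrite !scale1r addr0 => /eqP; rewrite eq_sym -subr_eq0 addrK => /eqP //.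
Qed.

Lemma rep_opZ a (c : R[i]) f : D f -> pi a (c *: f) = c *: pi a f.
Proof.
move=> Df; have := star_rep_op_linear rep a c Df rep_dom0.
by rewrite addr0 rep_op0 addr0.
Qed.

Lemma rep_opD a f g : D f -> D g -> pi a (f + g) = pi a f + pi a g.
Proof.
by move=> Df Dg; have := star_rep_op_linear rep a 1 Df Dg; rewrite !scale1r.
Qed.

Lemma rep_0 f : D f -> pi 0 f = 0.
Proof.
move=> Df; have := star_rep_linear rep 1 0 0 Df.
rewrite !scale1r addr0 => /eqP; rewrite eq_sym -subr_eq0 addrK => /eqP //.
Qed.

Lemma rep_Z (c : R[i]) a f : D f -> pi (c *: a) f = c *: pi a f.
Proof.
by move=> Df; have := star_rep_linear rep c a 0 Df; rewrite addr0 rep_0 // addr0.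
Qed.

Lemma rep_D a b f : D f -> pi (a + b) f = pi a f + pi b f.
Proof. by move=> Df; have := star_rep_linear rep 1 a b Df; rewrite !scale1r. Qed.

Lemma rep_sub_dom X : D = smooth_dom X -> forall f, D f -> op_dom X f.
Proof. by move=> -> f /(_ 1%N); case. Qed.

Lemma rep_sqnorm a xi : D xi ->
  complex.Re (inner H (pi (qplane_star a * a) xi) xi) = sqnorm (pi a xi).
Proof.
move=> Dxi; rewrite (star_rep_mul rep) // (star_rep_star rep) ?qplane_starK //.
exact: (star_rep_stable rep).
Qed.

Let stable a f : D f -> D (pi a f). Proof. exact: (star_rep_stable rep). Qed.

Ltac Dauto := repeat first
  [assumption | apply: stable | apply: rep_domZ | apply: rep_domD].

Lemma rep_witness xi : D xi ->
  witness_value (fun a => inner H (pi a xi) xi) = witness_form q x y xi.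
Proof.
move=> Dxi; rewrite /witness_value !rep_sqnorm // (star_rep_one rep) //.
rewrite /witness_form.
have xy_rel f : D f -> x (y f) = q%:C *: y (x f).
  move=> Df; rewrite /x /y -!(star_rep_mul rep) // qplane_relation.
  exact: rep_Z.
have N_ : pi (mono q (1, 1)%N) xi = number_op x y xi.
  by rewrite mono11 (star_rep_mul rep).
have -> : pi (npol q) xi = number_op x y xi - xi.
  rewrite /npol rep_D // N_ rep_Z // (star_rep_one rep) // rmorphN1 scaleN1r //.
have -> : pi (vpol q) xi = vop q x y xi.
  rewrite /vpol rep_D // !rep_Z // /vop /number_op xy_rel; last by Dauto.
  by rewrite mono12 mono30 !(star_rep_mul rep); Dauto.
have -> : complex.Re (inner H (pi (mono q (0, 4)%N) xi) xi) = rinner (x (x xi)) (y (y xi)).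
  rewrite mono04 !(star_rep_mul rep); Dauto.
  by rewrite /rinner !(star_rep_star rep); Dauto.
by rewrite N_.
Qed.

(** [x'] acts as the adjoint of [X] although it is adjoint to [x] only on [D]:
    the two agree when tested against the dense subspace [D]. *)
Lemma rep_adjoint (X : linear_operator H) : q_normal q X -> D = smooth_dom X ->
  (forall f, D f -> x f = X f) -> forall f, D f -> adjoint X f = y f.
Proof.
move=> [dX domX _] DX xX f Df; apply/eqP; rewrite -subr_eq0; apply/eqP.
have Xf : adjoint_dom X f by rewrite -domX; exact: (rep_sub_dom DX).
apply: (dense_ortho (star_rep_dense rep)) => g Dg; rewrite linearBr; apply/eqP.
rewrite subr_eq0 -[X in X == _](adjointP Xf); last exact: (rep_sub_dom DX).
by rewrite -xX // /x (star_rep_star rep).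
Qed.

(** Take [h = s x' u] with [u] the solution for [s = e^-2]; then [x^j u] solves the
    problem for [q^j s] with datum [x (x^(j-1) f)], and [weak_sol_small] applies. *)
Lemma rep_range_approx f : D f -> exists2 M : R, 0 <= M &
  forall e : R, 0 < e -> e <= 1 -> range_approx D x f M e.
Proof.
case: wb => X [qX DX piX] Df.
have xX g : D g -> x g = X g by exact: piX.
have yX := rep_adjoint qX DX xX.
pose m1 := q^-1 * sqnorm f; pose m2 := q ^- 2 * sqnorm (x f).
pose m3 := q ^- 3 * sqnorm (x (x f)).
have m1_ge0 : 0 <= m1 by rewrite mulr_ge0 ?sqnorm_ge0 // invr_ge0 ltW.
have m2_ge0 : 0 <= m2 by rewrite mulr_ge0 ?sqnorm_ge0 // invr_ge0 exprn_ge0 // ltW.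
have m3_ge0 : 0 <= m3 by rewrite mulr_ge0 ?sqnorm_ge0 // invr_ge0 exprn_ge0 // ltW.
exists (m1 + m2 + m3) => [|e e0 _]; first by rewrite !addr_ge0.
have e2 : 0 < e ^+ 2 by rewrite exprn_gt0.
pose s := e ^- 2; have s0 : 0 < s by rewrite invr_gt0.
have [u us] := weak_sol_ex qX f s0.
have Du : D u by rewrite DX; apply: (weak_sol_smooth q_gt0 qX s0 us); rewrite -DX.
have Dx g : D g -> D (x g) by exact: stable.
have domf g : D g -> op_dom X g by exact: (rep_sub_dom DX).
have step t g : 0 < t -> D g -> forall w, D w -> weak_sol X t w g ->
    weak_sol X (q * t) (x w) (x g).
  move=> t0 Dg w Dw wg; rewrite !xX //.
  exact: (weak_solX q_gt0 qX t0 wg (domf _ Dg)).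
have small t g w : 0 < t -> D g -> weak_sol X t w (x g) -> sqnorm w <= sqnorm g / t.
  by move=> t0 Dg; rewrite xX //; exact: (weak_sol_small qX t0 (domf _ Dg)).
have s1 : 0 < q * s by rewrite mulr_gt0.
have s2 : 0 < q * (q * s) by rewrite mulr_gt0.
have s3 : 0 < q * (q * (q * s)) by rewrite mulr_gt0.
have u1 := step s f s0 Df u Du us.
have u2 := step _ _ s1 (Dx _ Df) _ (Dx _ Du) u1.
have u3 := step _ _ s2 (Dx _ (Dx _ Df)) _ (Dx _ (Dx _ Du)) u2.
have b1 := small _ _ _ s1 Df u1.
have b2 := small _ _ _ s2 (Dx _ Df) u2.
have b3 := small _ _ _ s3 (Dx _ (Dx _ Df)) u3.
have M_le m : m <= m1 + m2 + m3 -> m * e ^+ 2 <= (m1 + m2 + m3) * e ^+ 2.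
  by move=> ?; apply: ler_wpM2r => //; exact: ltW.
have xh : f - u = x (s%:C *: y u).
  case: (weak_sol_strong q_gt0 qX s0 us) => _ ->.
  rewrite -xX // yX; last exact: Dx.
  rewrite [RHS]rep_opZ; last exact: stable.
  rewrite /x /y -!(star_rep_mul rep) // qplane_relation.
  by rewrite rep_Z // scalerA -rmorphM.
exists (s%:C *: y u), u; split.
  by split; Dauto; rewrite rmorphN1 scaleN1r.
split.
- rewrite -xh; exact: (weak_sol_contract s0 us).
- apply: le_trans b1 _; apply: le_trans (M_le m1 _); last by lra.
  by rewrite /m1 /s le_eqVlt; apply/orP; left; apply/eqP; field; rewrite !gt_eqF.
- apply: le_trans b2 _; apply: le_trans (M_le m2 _); last by lra.
  by rewrite /m2 /s le_eqVlt; apply/orP; left; apply/eqP; field; rewrite !gt_eqF.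
- apply: le_trans b3 _; apply: le_trans (M_le m3 _); last by lra.
  by rewrite /m3 /s le_eqVlt; apply/orP; left; apply/eqP; field; rewrite !gt_eqF.
Qed.

Lemma rep_witness_ge0 xi : D xi -> 0 <= witness_form q x y xi.
Proof.
move=> Dxi; have [M M0 app] := rep_range_approx Dxi.
apply: (@witness_form_ge0 _ _ _ D _ _ q_gt0 _ _ _ _ _ _ _ _ _ _ _ M) => //.
- exact: rep_domD.
- by move=> a f; exact: rep_domZ.
- by move=> f; exact: stable.
- by move=> f; exact: stable.
- exact: rep_opD.
- exact: rep_opD.
- by move=> a f; exact: rep_opZ.
- by move=> a f; exact: rep_opZ.
- by move=> f g Df Dg; rewrite /rinner /x /y (star_rep_star rep).
- move=> f Df; rewrite /x /y -!(star_rep_mul rep) // qplane_relation.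
  exact: rep_Z.
Qed.

End Rep.

Lemma q_moment_witness (R : realType) (q : R) (F : {scalar qplane q}) :
  0 < q -> q_moment_functional F -> 0 <= witness_value F.
Proof.
move=> q0 [H [D [pi [xi [rep wb Dxi FE]]]]].
have := rep_witness_ge0 q0 rep wb Dxi; rewrite -(rep_witness rep Dxi).
by rewrite /witness_value !FE.
Qed.

(** * Linear functionals given by moment tables *)

Section Functional.
Variables (R : realType) (q : R).
Notation C := R[i].
Notation table := (nat -> nat -> C).

(** If [m i j] is the value of a functional [F] at [x'^i x^j], then [table_act s m]
    is the table of [c |-> F (c s)].  This left action turns a table into a
    functional on the quotient, with no need of a basis. *)
Fixpoint table_act (s : qexpr R) (m : table) : table :=
  match s with
  | qcst c => fun i j => c * m i j
  | qx => fun i j => m i j.+1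
  | qxs => fun i j => (q ^+ j)%:C * m i.+1 j
  | qadd s t => fun i j => table_act s m i j + table_act t m i j
  | qmul s t => table_act s (table_act t m)
  end.

Lemma table_actP s (c : C) (m m' : table) i j :
  table_act s (fun i j => c * m i j + m' i j) i j =
  c * table_act s m i j + table_act s m' i j.
Proof.
elim: s m m' i j => [d|||s IHs t IHt|s IHs t IHt] m m' i j /=; rewrite ?IHs ?IHt; try ring.
rewrite -IHs; congr (table_act s _ i j).
by apply/funext => k; apply/funext => l; rewrite IHt.
Qed.

Lemma table_actZ s (c : C) (m : table) :
  table_act s (fun i j => c * m i j) = (fun i j => c * table_act s m i j).
Proof.
apply/funext => i; apply/funext => j.
have := table_actP s c m (fun _ _ => 0) i j.
have e : (fun i j => c * m i j + 0) = (fun i j => c * m i j).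
  by apply/funext => k; apply/funext => l; rewrite addr0.
have := table_actP s 0 m (fun _ _ => 0) i j.
have -> : (fun i j => 0 * m i j + 0) = (fun _ _ => 0) :> table.
  by apply/funext => k; apply/funext => l; rewrite mul0r addr0.
have := table_actP s 1 (fun _ _ => 0) (fun _ _ => 0) i j.
have -> : (fun i j => 1 * (0 : C) + 0) = (fun _ _ => 0) :> table.
  by apply/funext => k; apply/funext => l; rewrite mulr0 addr0.
rewrite mul1r => /eqP; rewrite -subr_eq0 opprD addrA subrr add0r oppr_eq0 => /eqP z _.
by rewrite e z addr0.
Qed.

Lemma table_actD s (m m' : table) :
  table_act s (fun i j => m i j + m' i j) =
  (fun i j => table_act s m i j + table_act s m' i j).
Proof.
apply/funext => i; apply/funext => j.
have := table_actP s 1 m m' i j; rewrite mul1r => <-; congr (table_act s _ i j).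
by apply/funext => k; apply/funext => l; rewrite mul1r.
Qed.

Lemma table_act_qeq s t : qeq q s t -> forall m, table_act s m = table_act t m.
Proof.
elim=> //=.
- by move=> ? ? ? _ e1 _ e2 m; rewrite e1 e2.
- by move=> ? ? ? ? _ e1 _ e2 m; apply/funext => i; apply/funext => j; rewrite e1 e2.
- by move=> ? ? ? ? _ e1 _ e2 m; rewrite e1 e2.
- by move=> *; apply/funext => i; apply/funext => j; rewrite addrA.
- by move=> *; apply/funext => i; apply/funext => j; rewrite addrC.
- by move=> *; apply/funext => i; apply/funext => j; rewrite mul0r add0r.
- by move=> *; apply/funext => i; apply/funext => j; rewrite mulN1r addNr mul0r.
- by move=> *; apply/funext => i; apply/funext => j; rewrite mul1r.
- by move=> s0 t0 u m; rewrite table_actD.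
- by move=> *; apply/funext => i; apply/funext => j; rewrite mulrDl.
- by move=> *; apply/funext => i; apply/funext => j; rewrite mulrA.
- by move=> a s0 m; rewrite table_actZ.
- by move=> m; apply/funext => i; apply/funext => j; rewrite exprS rmorphM mulrA.
Qed.

Definition table_value (m : table) (a : qplane q) : C :=
  table_act (qrep a) m 0%N 0%N.

Lemma table_value_class m s : table_value m (qclass q s) = table_act s m 0%N 0%N.
Proof. by rewrite /table_value (table_act_qeq (qclassK q s)). Qed.

Lemma table_value_linear m : linear_for *%R (table_value m).
Proof.
move=> c a b; rewrite -(qrepK a) -(qrepK b) -mulr_algl -qclass_cst -qclassM -qclassD.
by rewrite !table_value_class.
Qed.

HB.instance Definition _ m := GRing.isLinear.Build C (qplane q) C *%R
  (table_value m) (table_value_linear m).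

Definition table_functional (m : table) : {scalar qplane q} := table_value m.

Lemma table_valueM m a b :
  table_value m (a * b) = table_value (table_act (qrep b) m) a.
Proof.
by rewrite -{1}(qrepK a) -{1}(qrepK b) -qclassM table_value_class.
Qed.

Lemma table_value_mulx m a :
  table_value m (a * qplane_x q) = table_value (fun i j => m i j.+1) a.
Proof. by rewrite table_valueM (table_act_qeq (qclassK q qx)). Qed.

Lemma table_value_mulxs m a : table_value m (a * qplane_star (qplane_x q)) =
  table_value (fun i j => (q ^+ j)%:C * m i.+1 j) a.
Proof.
by rewrite qplane_star_class table_valueM (table_act_qeq (qclassK q qxs)).
Qed.

Lemma table_value1 m : table_value m 1 = m 0%N 0%N.
Proof. by rewrite table_value_class /= mul1r. Qed.

Lemma table_value_mulxn m a n :
  table_value m (a * qplane_x q ^+ n) = table_value (fun i j => m i (j + n)%N) a.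
Proof.
elim: n m => [|n IH] m.
  rewrite expr0 mulr1; congr table_value.
  by apply/funext => i; apply/funext => j; rewrite addn0.
rewrite exprSr mulrA table_value_mulx IH; congr table_value.
by apply/funext => i; apply/funext => j; rewrite addnS.
Qed.

Lemma table_value_mono m p : table_value m (mono q p) = m p.1 p.2.
Proof.
rewrite /mono table_value_mulxn; case: p => i j /=.
have : forall m' : table, table_value m' (qplane_star (qplane_x q) ^+ i) = m' i 0%N.
  elim: i => [|i IH] m'; first by rewrite expr0 table_value1.
  by rewrite exprSr table_value_mulxs IH expr0 mul1r.
by move=> ->; rewrite add0n.
Qed.

End Functional.

(** * Monomials and positivity through Gram matrices *)

Section Spanning.
Variables (R : realType) (q : R).
Notation C := R[i].
Notation x := (qplane_x q).
Notation xs := (qplane_star (qplane_x q)).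

Lemma x_mul_xsn n : x * xs ^+ n = (q ^+ n)%:C *: (xs ^+ n * x).
Proof.
elim: n => [|n IH]; first by rewrite !expr0 mul1r mulr1 scale1r.
rewrite exprSr mulrA IH -scalerAl -(mulrA _ x xs) qplane_relation -scalerAr.
by rewrite scalerA -rmorphM /= (exprSr q) mulrA.
Qed.

Lemma xm_mul_xsn m n : x ^+ m * xs ^+ n = (q ^+ (m * n)%N)%:C *: (xs ^+ n * x ^+ m).
Proof.
elim: m => [|m IH]; first by rewrite !expr0 mul1r mulr1 scale1r.
rewrite exprS -(mulrA x) IH -scalerAr (mulrA x) x_mul_xsn -scalerAl scalerA.
by rewrite -(mulrA _ x) -rmorphM -exprD mulSn addnC.
Qed.

Lemma star1 : qplane_star (1 : qplane q) = 1.
Proof.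
have := qplane_starM (1 : qplane q) (qplane_star 1).
by rewrite !mul1r qplane_starK mul1r => <-.
Qed.

Lemma starX (a : qplane q) n : qplane_star (a ^+ n) = qplane_star a ^+ n.
Proof.
elim: n => [|n IH]; first by rewrite !expr0 star1.
by rewrite exprS qplane_starM IH -exprSr.
Qed.

Lemma star_mono p : qplane_star (mono q p) = mono q (p.2, p.1).
Proof. by rewrite /mono qplane_starM !starX qplane_starK. Qed.

Lemma mono_mul p r : mono q p * mono q r =
  (q ^+ (p.2 * r.1)%N)%:C *: mono q (p.1 + r.1, p.2 + r.2)%N.
Proof.
rewrite /mono /= mulrA -(mulrA (xs ^+ _)) xm_mul_xsn -scalerAr -!scalerAl.
by rewrite !mulrA -exprD -!mulrA -exprD.
Qed.

Definition comb (s : seq (C * (nat * nat))) : qplane q :=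
  \sum_(t <- s) t.1 *: mono q t.2.

Lemma mono00 : mono q (0, 0)%N = 1.
Proof. by rewrite /mono !expr0 mulr1. Qed.

(** Normal ordering: the defining relation moves every [x] to the right of every
    [x']. *)
Lemma comb_surj a : exists s, a = comb s.
Proof.
elim/qclass_surj: a; elim=> [c|||s [u us] t [v vt]|s [u us] t [v vt]].
- by exists [:: (c, (0, 0)%N)]; rewrite /comb big_seq1 mono00 qclass_cst.
- by exists [:: (1, (0, 1)%N)]; rewrite /comb big_seq1 scale1r /mono mul1r expr1.
- exists [:: (1, (1, 0)%N)].
  by rewrite /comb big_seq1 scale1r /mono mulr1 expr1 qplane_star_class.
- by exists (u ++ v); rewrite qclassD us vt /comb big_cat.
- exists [seq (w.1 * z.1 * (q ^+ (w.2.2 * z.2.1)%N)%:C,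
              (w.2.1 + z.2.1, w.2.2 + z.2.2)%N) | w <- u, z <- v].
  rewrite qclassM us vt /comb big_allpairs_dep mulr_suml; apply: eq_bigr => w _.
  rewrite mulr_sumr; apply: eq_bigr => z _.
  by rewrite -scalerAl -scalerAr scalerA mono_mul scalerA.
Qed.

End Spanning.

Section Gram.
Variables (R : realType) (q : R) (mu : nat -> nat -> R).
Hypothesis mu_sym : forall i j, mu i j = mu j i.
Notation C := R[i].

(** The value at [b_p' b_r], with [b_p = x'^p.1 x^p.2], of the functional with
    moments [mu]. *)
Definition gram (p r : nat * nat) : R :=
  q ^+ (p.1 * r.1)%N * mu (p.2 + r.1)%N (p.1 + r.2)%N.

Lemma gram_sym p r : gram p r = gram r p.
Proof. by rewrite /gram mulnC mu_sym addnC (addnC p.2). Qed.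

Definition moment_functional : {scalar qplane q} :=
  table_functional q (fun i j => (mu i j)%:C).

Lemma moment_mono p r :
  moment_functional (qplane_star (mono q p) * mono q r) = (gram p r)%:C.
Proof.
rewrite star_mono mono_mul linearZ /= /moment_functional /table_functional.
by rewrite table_value_mono /= -rmorphM.
Qed.

Definition gram_form (G : nat * nat -> nat * nat -> R) L (a : nat * nat -> R) : R :=
  \sum_(p <- L) \sum_(r <- L) a p * a r * G p r.

Lemma gram_form_collect (s : seq (C * (nat * nat))) (f : C * (nat * nat) -> R) L :
  uniq L -> {in s, forall t, t.2 \in L} ->
  \sum_(t <- s) \sum_(t' <- s) f t * f t' * gram t.2 t'.2 =
  gram_form gram L (fun p => \sum_(t <- s | t.2 == p) f t).
Proof.
move=> uL sL.
have collect (phi : nat * nat -> R) :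
    \sum_(p <- L) (\sum_(t <- s | t.2 == p) f t) * phi p =
    \sum_(t <- s) f t * phi t.2.
  under eq_bigr => p _ do rewrite mulr_suml big_mkcond.
  rewrite exchange_big /= big_seq [RHS]big_seq; apply: eq_bigr => t /sL tL.
  rewrite (bigD1_seq t.2) //= eqxx big1 ?addr0 // => p /negPf.
  by rewrite eq_sym => ->.
rewrite /gram_form; under [RHS]eq_bigr => p _.
  under eq_bigr => r _ do rewrite -mulrA (mulrC (\sum_(_ <- _ | _ == r) _)) mulrA.
  over.
rewrite [RHS](_ : _ = \sum_(p <- L) (\sum_(t <- s | t.2 == p) f t) *
   (\sum_(r <- L) (\sum_(t <- s | t.2 == r) f t) * gram p r)); last first.
  by apply: eq_bigr => p _; rewrite mulr_sumr; apply: eq_bigr => r _; ring.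
rewrite collect; apply: eq_bigr => t _.
by rewrite collect mulr_sumr; apply: eq_bigr => t' _; ring.
Qed.

(** The Gram matrix is real and symmetric, so that the value at [a' a] is the sum
    of the real forms at the real and at the imaginary parts of the coefficients;
    the mixed terms cancel. *)
Lemma moment_functional_positive (L : nat -> seq (nat * nat)) :
  (forall n, uniq (L n)) ->
  (forall s : seq (nat * nat), exists n, {subset s <= L n}) ->
  (forall n a, 0 <= gram_form gram (L n) a) ->
  positive_functional moment_functional.
Proof.
move=> uL covL posL a; have [s ->] := comb_surj a.
have [n sn] := covL [seq t.2 | t <- s].
have sL : {in s, forall t, t.2 \in L n} by move=> t ts; apply/sn/map_f.
pose re (t : C * (nat * nat)) := complex.Re t.1.
pose im (t : C * (nat * nat)) := complex.Im t.1.
suff -> : moment_functional (qplane_star (comb q s) * comb q s) =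
   (\sum_(t <- s) \sum_(t' <- s) re t * re t' * gram t.2 t'.2 +
    \sum_(t <- s) \sum_(t' <- s) im t * im t' * gram t.2 t'.2)%:C.
  by rewrite ler0c !(gram_form_collect _ (uL n) sL) addr_ge0 ?posL.
have star_comb : qplane_star (comb q s) =
    \sum_(t <- s) Num.conj t.1 *: qplane_star (mono q t.2).
  rewrite /comb; elim: s {sn sL} => [|t s IH].
    by rewrite !big_nil -(scale0r 1) qplane_starZ rmorph0 !scale0r.
  by rewrite !big_cons qplane_starD qplane_starZ IH.
rewrite star_comb /comb mulr_suml linear_sum /=.
pose cross (t t' : C * (nat * nat)) := re t * im t' * gram t.2 t'.2.
have skew : \sum_(t <- s) \sum_(t' <- s) cross t t' =
            \sum_(t <- s) \sum_(t' <- s) cross t' t by exact: exchange_big.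
transitivity ((\sum_(t <- s) \sum_(t' <- s) re t * re t' * gram t.2 t'.2 +
    \sum_(t <- s) \sum_(t' <- s) im t * im t' * gram t.2 t'.2)%:C +
  'i%C * (\sum_(t <- s) \sum_(t' <- s) cross t t'
     - \sum_(t <- s) \sum_(t' <- s) cross t' t)%:C).
  rewrite rmorphB rmorphD /= !rmorph_sum -!sumrB -big_split /= mulr_sumr -big_split /=.
  apply: eq_bigr => t _; rewrite mulr_sumr linear_sum /= !rmorph_sum.
  rewrite -sumrB mulr_sumr -!big_split /=; apply: eq_bigr => t' _.
  rewrite -scalerAl -scalerAr scalerA linearZ /= moment_mono /cross /re /im.
  rewrite (gram_sym t'.2); case: (t) => -[a1 b1] p; case: (t') => -[a2 b2] r /=.
  by simpc; congr (_ +i* _); ring.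
by rewrite skew subrr mulr0 addr0.
Qed.

End Gram.

(** * Coercive Gram matrices and their extensions *)

Section Coercive.
Variables (R : realType).
Notation pair := (nat * nat)%type.
Implicit Types (G : pair -> pair -> R) (I J L : seq pair) (a : pair -> R).

Definition sqsum L a : R := \sum_(p <- L) a p ^+ 2.

(** Positive definiteness with a uniform constant, as needed to enlarge [L]. *)
Definition coercive G L :=
  exists2 c : R, 0 < c & forall a, sqsum L a <= c * gram_form G L a.

Lemma sqsum_ge0 L a : 0 <= sqsum L a.
Proof. by apply: sumr_ge0 => p _; exact: sqr_ge0. Qed.

Lemma coercive_ge0 G L a : coercive G L -> 0 <= gram_form G L a.
Proof.
by move=> [c c0 /(_ a)] h; rewrite -(pmulr_rge0 _ c0) (le_trans (sqsum_ge0 L a)).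
Qed.

Lemma eq_gram_form G G' L : {in L &, G =2 G'} ->
  forall a, gram_form G L a = gram_form G' L a.
Proof.
move=> GG' a; rewrite /gram_form big_seq [RHS]big_seq; apply: eq_bigr => p pL.
by rewrite big_seq [RHS]big_seq; apply: eq_bigr => r rL; rewrite GG'.
Qed.

Lemma eq_coercive G G' L : {in L &, G =2 G'} -> coercive G L -> coercive G' L.
Proof.
by move=> GG' [c c0 h]; exists c => // a; rewrite -(eq_gram_form GG').
Qed.

Lemma gram_form_cat G I J a : {in I & J, forall i j, G i j = G j i} ->
  gram_form G (I ++ J) a = gram_form G I a +
  \sum_(i <- I) \sum_(j <- J) 2 * (a i * a j * G i j) + gram_form G J a.
Proof.
move=> sG; rewrite /gram_form big_cat /=.
under eq_bigr => p _ do rewrite big_cat.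
under [X in _ + X = _]eq_bigr => p _ do rewrite big_cat.
rewrite /= !big_split /= -!addrA; congr (_ + _); rewrite addrA; congr (_ + _).
rewrite [X in _ + X = _]exchange_big -big_split /= big_seq [RHS]big_seq.
apply: eq_bigr => i iI; rewrite -big_split big_seq [RHS]big_seq.
by apply: eq_bigr => j jJ /=; rewrite -(sG i j) //; ring.
Qed.

Lemma cross_bound (B : pair -> pair -> R) I J a (t : R) : 0 < t ->
  - (t * (size J)%:R * sqsum I a +
     t^-1 * (\sum_(i <- I) \sum_(j <- J) B i j ^+ 2) * sqsum J a) <=
  \sum_(i <- I) \sum_(j <- J) 2 * (a i * a j * B i j).
Proof.
move=> t0; set beta := \sum_(i <- I) _.
have -> : t * (size J)%:R * sqsum I a = \sum_(i <- I) \sum_(j <- J) t * a i ^+ 2.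
  rewrite /sqsum mulr_sumr; apply: eq_bigr => i _.
  by rewrite big_const_seq count_predT iter_addr_0 -mulr_natr; ring.
have h : \sum_(i <- I) \sum_(j <- J) t^-1 * (B i j ^+ 2 * a j ^+ 2) <=
   t^-1 * beta * sqsum J a.
  under eq_bigr => i _ do rewrite -mulr_sumr.
  rewrite -mulr_sumr -mulrA ler_pM2l ?invr_gt0 // /beta mulr_suml.
  apply: ler_sum => i _; rewrite mulr_suml big_seq [leRHS]big_seq; apply: ler_sum => j jJ.
  apply: ler_wpM2l; first exact: sqr_ge0.
  by rewrite /sqsum (big_rem j) //= lerDl; apply: sumr_ge0 => k _; exact: sqr_ge0.
apply: (@le_trans _ _ (- (\sum_(i <- I) \sum_(j <- J) t * a i ^+ 2 +
    \sum_(i <- I) \sum_(j <- J) t^-1 * (B i j ^+ 2 * a j ^+ 2)))).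
  by rewrite lerN2 lerD2l.
rewrite -big_split -sumrN; apply: ler_sum => i _.
rewrite -big_split -sumrN; apply: ler_sum => j _ /=.
have : 0 <= t^-1 * (t * a i + B i j * a j) ^+ 2.
  by rewrite mulr_ge0 ?sqr_ge0 // invr_ge0 ltW.
have -> : t^-1 * (t * a i + B i j * a j) ^+ 2 =
  t * a i ^+ 2 + 2 * (a i * a j * B i j) + t^-1 * (B i j ^+ 2 * a j ^+ 2).
  by field; rewrite gt_eqF.
lra.
Qed.

(** If the diagonal block over [J] grows with [M] and the rest of the matrix is
    fixed, then for large [M] it dominates the cross terms with [I]: Young's
    inequality gives half of the form over [I] to them, and the remainder is a
    fixed multiple of the square sum over [J]. *)
Lemma coercive_extend (G0 : pair -> pair -> R) (G : R -> pair -> pair -> R)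
    I J (w : R) : 0 < w ->
  (forall M, {in I &, G M =2 G0}) ->
  (forall M, {in I & J, G M =2 G0}) ->
  (forall M, {in I & J, forall i j, G M i j = G M j i}) ->
  (forall M a, 0 <= M -> M * w * sqsum J a <= gram_form (G M) J a) ->
  coercive G0 I -> exists M, coercive (G M) (I ++ J).
Proof.
move=> w0 GI GIJ Gs GJ [c c0 cP].
pose n : R := (size J)%:R; have n0 : 0 <= n by rewrite ler0n.
pose beta := \sum_(i <- I) \sum_(j <- J) G0 i j ^+ 2.
have b0 : 0 <= beta by do 2![apply: sumr_ge0 => ? _]; exact: sqr_ge0.
pose t := (2 * c * (n + 1))^-1.
have t0 : 0 < t by rewrite invr_gt0 !mulr_gt0 //; lra.
pose M := (t^-1 * beta + 1) / w.
have M0 : 0 <= M.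
  apply: divr_ge0; last exact: ltW.
  by rewrite addr_ge0 // mulr_ge0 // invr_ge0 ltW.
exists M, (2 * c + 1) => [|a]; first by lra.
rewrite (gram_form_cat _ (Gs M)) (eq_gram_form (GI M)) /sqsum big_cat /= -!/(sqsum _ a).
have -> : \sum_(i <- I) \sum_(j <- J) 2 * (a i * a j * G M i j) =
    \sum_(i <- I) \sum_(j <- J) 2 * (a i * a j * G0 i j).
  rewrite big_seq [RHS]big_seq; apply: eq_bigr => i iI.
  by rewrite big_seq [RHS]big_seq; apply: eq_bigr => j jJ; rewrite GIJ.
have := GJ M a M0; have := cross_bound G0 I J a t0; rewrite -/beta -/n.
have -> : M * w = t^-1 * beta + 1 by rewrite /M divfK // gt_eqF.
have := cP a; have := sqsum_ge0 I a; have := sqsum_ge0 J a.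
move: (sqsum I a) (sqsum J a) (gram_form _ I a) (gram_form _ J a) => SI SJ EI EJ.
move: (\sum_(i <- I) _) (t^-1 * beta) => X tb SJ0 SI0 h1 h2 h3.
have tn : t * n * SI <= EI / 2.
  have -> : EI / 2 = t * (n + 1) * (c * EI).
    by rewrite /t; field; rewrite !gt_eqF //; lra.
  rewrite -!mulrA; apply: ler_wpM2l; first exact: ltW.
  by apply: le_trans (ler_wpM2l n0 h1) _; rewrite mulrDl mul1r; lra.
have EI0 : 0 <= EI by rewrite -(pmulr_rge0 _ c0); lra.
have : 0 <= c * SJ by rewrite mulr_ge0 // ltW.
have : EI / 2 + SJ <= EI + X + EJ by rewrite mulrDl mul1r in h3; lra.
move=> k1 k2; have k3 : 0 < 2 * c + 1 by lra.
have := ler_wpM2l (ltW k3) k1; lra.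
Qed.

End Coercive.

(** * The low moments *)

Definition deg_pairs n : seq (nat * nat) := [seq (m, n - m)%N | m <- iota 0 n.+1].
Arguments deg_pairs : simpl never.

Fixpoint pairs_below n : seq (nat * nat) :=
  if n is n'.+1 then pairs_below n' ++ deg_pairs n' else [::].

Lemma mem_deg_pairs n p : (p \in deg_pairs n) = (p.1 + p.2 == n)%N.
Proof.
apply/mapP/eqP => [[m]|pn].
  by rewrite mem_iota => mn -> /=; lia.
by exists p.1; [rewrite mem_iota; lia | case: p pn => i j /= <-; congr (_, _); lia].
Qed.

Lemma mem_pairs_below n p : (p \in pairs_below n) = (p.1 + p.2 < n)%N.
Proof.
by elim: n => //= n IH; rewrite mem_cat IH mem_deg_pairs ltnS [RHS]leq_eqVlt orbC.
Qed.

Lemma uniq_pairs_below n : uniq (pairs_below n).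
Proof.
elim: n => //= n IH; rewrite cat_uniq IH andTb; apply/andP; split.
  by apply/hasPn => p; rewrite mem_deg_pairs mem_pairs_below => /eqP ->; rewrite ltnn.
by rewrite map_inj_uniq ?iota_uniq // => i j [].
Qed.

Lemma pairs_below_cover (s : seq (nat * nat)) : exists n, {subset s <= pairs_below n}.
Proof.
elim: s => [|p s [n sn]]; first by exists 0%N.
exists (maxn n (p.1 + p.2).+1)%N => r; rewrite inE => /predU1P[->|/sn].
  by rewrite mem_pairs_below leq_max leqnn orbT.
by rewrite !mem_pairs_below leq_max => ->.
Qed.

Section Table.
Variables (R : realType) (q eta : R).
Hypothesis q_gt0 : 0 < q.
Hypotheses (eta_gt0 : 0 < eta) (eta_le : eta <= 1 / 10).
Let qu : q != 0. Proof. by rewrite gt_eqF. Qed.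

(** Indices of the only nonzero moments off the diagonal, those of [x' x^5] and of
    its adjoint. *)
Definition twisted (i j : nat) := ((i == 5) && (j == 1) || (i == 1) && (j == 5))%N.

(** The off-diagonal value differs from [q^2 g 3], the one that would make
    [F (v' v)] vanish, by just enough for [F (v' v) = 3/2]. *)
Definition mu_table (g : nat -> R) (i j : nat) : R :=
  if i == j then g i else if twisted i j then q ^+ 2 * g 3%N - 3 / (4 * q) else 0.

Lemma mu_table_sym g i j : mu_table g i j = mu_table g j i.
Proof.
by rewrite /mu_table /twisted eq_sym orbC andbC (andbC (j == 1)%N); case: eqP => // ->. Qed.

(** That is, [F (N^i)] is [1], [1], [1 + eta] and [10] for [i = 0, 1, 2, 3]. *)
Definition low_moments (g : nat -> R) :=
  [/\ g 0%N = 1, g 1%N = 1, g 2%N = (1 + eta) / q & g 3%N = 10 / q ^+ 3].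

(** Up to scaling, the Gram form on the span of [x], [x' x^2] and [x'^3], where [b]
    is the coordinate of the cube when [v] replaces the second monomial.
    The minor of [x] and [a] is [3/2 - (1 + eta)^2 > 0]: here it matters that
    [F (v' v)] exceeds [1]. *)
Lemma odd_block_bound (x a b : R) :
  (x ^+ 2 + a ^+ 2 + b ^+ 2) / 100 <=
  x ^+ 2 + 2 * (1 + eta) * x * a + 3 / 2 * a ^+ 2 - 3 / 2 * a * b + 10 * b ^+ 2.
Proof.
have e2 : (1 + eta) ^+ 2 <= 121 / 100.
  have : 0 <= eta * (1 / 10 - eta) by rewrite mulr_ge0 ?subr_ge0 // ltW.
  have -> : (1 + eta) ^+ 2 = 1 + 21 / 10 * eta - eta * (1 / 10 - eta) by field.
  by have := eta_le; lra.
have e3 : 0 <= (121 / 100 - (1 + eta) ^+ 2) * a ^+ 2.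
  by rewrite mulr_ge0 ?sqr_ge0 // subr_ge0.
have s1 := sqr_ge0 (x + 100 / 99 * (1 + eta) * a).
have s2 := sqr_ge0 (b - 3 / 40 * a).
have s3 := sqr_ge0 a; have s4 := sqr_ge0 b.
have -> : x ^+ 2 + 2 * (1 + eta) * x * a + 3 / 2 * a ^+ 2 - 3 / 2 * a * b + 10 * b ^+ 2 =
  (x ^+ 2 + a ^+ 2 + b ^+ 2) / 100 + 99 / 100 * (x + 100 / 99 * (1 + eta) * a) ^+ 2
  + 100 / 99 * ((121 / 100 - (1 + eta) ^+ 2) * a ^+ 2)
  + 999 / 100 * (b - 3 / 40 * a) ^+ 2
  + (149 / 100 - 121 / 99 - 999 / 100 * (9 / 1600)) * a ^+ 2
  + (3 / 2 - 999 / 100 * (3 / 20)) * (- a * b) by field.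
nra.
Qed.

(** The degree difference of monomials is preserved modulo 4 by nonzero entries, so the
    matrix splits into four blocks: [1, N]; [x, x' x^2, x'^3]; [x^2, x'^2];
    [x', x'^2 x, x^3]. *)
Lemma coercive_base g : low_moments g -> coercive (gram q (mu_table g)) (pairs_below 4).
Proof.
move=> [g0 g1 g2 g3].
pose c0 := 2 + 3 / eta.
pose c1 := 100 * (1 + q ^+ 2 + 2 * q ^- 6).
pose c2 := (1 + q ^- 4) * q.
pose c3 := 100 * (1 + 2 * q ^+ 4) / q.
have p2 : 0 < q ^+ 2 by rewrite exprn_gt0.
have p4 : 0 < q ^+ 4 by rewrite exprn_gt0.
have n4 : 0 < q ^- 4 by rewrite invr_gt0 exprn_gt0.
have n6 : 0 < q ^- 6 by rewrite invr_gt0 exprn_gt0.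
have c0p : 0 < c0 by rewrite /c0 addr_gt0 // divr_gt0 //; have := eta_gt0.
have c1p : 0 < c1 by rewrite /c1; lra.
have c2p : 0 < c2 by rewrite /c2 mulr_gt0 //; lra.
have c3p : 0 < c3 by rewrite /c3 divr_gt0 //; lra.
exists (c0 + c1 + c2 + c3) => [|a]; first by lra.
pose E0 := a (0, 0)%N ^+ 2 + 2 * a (0, 0)%N * a (1, 1)%N + (1 + eta) * a (1, 1)%N ^+ 2.
pose A1 := a (1, 2)%N / q; pose B1 := A1 + q ^+ 3 * a (3, 0)%N.
pose E1 := a (0, 1)%N ^+ 2 + 2 * (1 + eta) * a (0, 1)%N * A1 + 3 / 2 * A1 ^+ 2
  - 3 / 2 * A1 * B1 + 10 * B1 ^+ 2.
pose E2 := (1 + eta) / q * (a (0, 2)%N ^+ 2 + q ^+ 4 * a (2, 0)%N ^+ 2).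
pose A3 := a (2, 1)%N; pose B3 := A3 + a (0, 3)%N / q ^+ 2.
pose E3 := q * (a (1, 0)%N ^+ 2 + 2 * (1 + eta) * a (1, 0)%N * A3 + 3 / 2 * A3 ^+ 2
  - 3 / 2 * A3 * B3 + 10 * B3 ^+ 2).
have -> : gram_form (gram q (mu_table g)) (pairs_below 4) a = E0 + E1 + E2 + E3.
  rewrite /gram_form /= !big_cons !big_nil /gram /mu_table /= g0 g1 g2 g3.
  by rewrite /E0 /E1 /E2 /E3 /B1 /B3 /A1 /A3; field; rewrite qu.
have -> : sqsum (pairs_below 4) a = (a (0, 0)%N ^+ 2 + a (1, 1)%N ^+ 2) +
   (a (0, 1)%N ^+ 2 + a (1, 2)%N ^+ 2 + a (3, 0)%N ^+ 2) +
   (a (0, 2)%N ^+ 2 + a (2, 0)%N ^+ 2) +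
   (a (1, 0)%N ^+ 2 + a (2, 1)%N ^+ 2 + a (0, 3)%N ^+ 2).
  by rewrite /sqsum /= !big_cons !big_nil /=; ring.
have k0 : a (0, 0)%N ^+ 2 + a (1, 1)%N ^+ 2 <= c0 * E0.
  have -> : c0 * E0 = a (0, 0)%N ^+ 2 + a (1, 1)%N ^+ 2
     + (a (0, 0)%N + 2 * a (1, 1)%N) ^+ 2
     + 2 * eta * a (1, 1)%N ^+ 2 + 3 / eta * (a (0, 0)%N + a (1, 1)%N) ^+ 2.
    by rewrite /c0 /E0; field; rewrite gt_eqF.
  have := sqr_ge0 (a (0, 0)%N + 2 * a (1, 1)%N).
  have : 0 <= 2 * eta * a (1, 1)%N ^+ 2 by rewrite mulr_ge0 ?sqr_ge0 // mulr_ge0 // ltW.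
  have : 0 <= 3 / eta * (a (0, 0)%N + a (1, 1)%N) ^+ 2.
    by rewrite mulr_ge0 ?sqr_ge0 // divr_ge0 // ltW.
  lra.
have k1 : a (0, 1)%N ^+ 2 + a (1, 2)%N ^+ 2 + a (3, 0)%N ^+ 2 <= c1 * E1.
  have -> : a (1, 2)%N = q * A1 by rewrite /A1; field.
  have -> : a (3, 0)%N = q ^- 3 * (B1 - A1) by rewrite /B1; field.
  have -> : (q * A1) ^+ 2 = q ^+ 2 * A1 ^+ 2 by ring.
  have -> : (q ^- 3 * (B1 - A1)) ^+ 2 = q ^- 6 * (B1 - A1) ^+ 2 by field.
  have h := odd_block_bound (a (0, 1)%N) A1 B1.
  have := ler_wpM2l (ltW c1p) h; rewrite -/E1; apply: le_trans.
  have := mulr_ge0 (ltW n6) (sqr_ge0 (B1 + A1)).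
  have := mulr_ge0 (ltW n6) (sqr_ge0 (a (0, 1)%N)).
  have := mulr_ge0 (ltW p2) (sqr_ge0 (a (0, 1)%N)).
  have := mulr_ge0 (ltW p2) (sqr_ge0 B1).
  have := sqr_ge0 A1; have := sqr_ge0 B1.
  rewrite /c1; clearbody A1 B1; move: (q ^- 6) (q ^+ 2) (a _) => u v x. lra.
have k2 : a (0, 2)%N ^+ 2 + a (2, 0)%N ^+ 2 <= c2 * E2.
  have -> : c2 * E2 = (1 + eta) * (a (0, 2)%N ^+ 2 + a (2, 0)%N ^+ 2 +
     (q ^- 4 * a (0, 2)%N ^+ 2 + q ^+ 4 * a (2, 0)%N ^+ 2)).
    by rewrite /c2 /E2; field.
  have := mulr_ge0 (ltW n4) (sqr_ge0 (a (0, 2)%N)).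
  have := mulr_ge0 (ltW p4) (sqr_ge0 (a (2, 0)%N)).
  have := sqr_ge0 (a (0, 2)%N); have := sqr_ge0 (a (2, 0)%N) => w0 z0 y0 x0.
  have := mulr_ge0 (ltW eta_gt0) (addr_ge0 (addr_ge0 z0 w0) (addr_ge0 x0 y0)).
  lra.
have k3 : a (1, 0)%N ^+ 2 + a (2, 1)%N ^+ 2 + a (0, 3)%N ^+ 2 <= c3 * E3.
  have -> : a (0, 3)%N = q ^+ 2 * (B3 - A3) by rewrite /B3; field.
  rewrite -/A3; have -> : (q ^+ 2 * (B3 - A3)) ^+ 2 = q ^+ 4 * (B3 - A3) ^+ 2 by ring.
  have h := odd_block_bound (a (1, 0)%N) A3 B3.
  have cq : 0 <= c3 * q by rewrite mulr_ge0 // ltW.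
  rewrite /E3 mulrA; apply: le_trans (ler_wpM2l cq h).
  have -> : c3 * q = 100 * (1 + 2 * q ^+ 4) by rewrite /c3 divfK.
  have := mulr_ge0 (ltW p4) (sqr_ge0 (B3 + A3)).
  have := mulr_ge0 (ltW p4) (sqr_ge0 (a (1, 0)%N)).
  have := sqr_ge0 A3; have := sqr_ge0 B3.
  clearbody B3; move: (q ^+ 4) (A3) (a _) => u x y; lra.
have s0 : 0 <= E0.
  by rewrite -(pmulr_rge0 _ c0p); apply: le_trans k0; rewrite !addr_ge0 ?sqr_ge0.
have s1 : 0 <= E1.
  by rewrite -(pmulr_rge0 _ c1p); apply: le_trans k1; rewrite !addr_ge0 ?sqr_ge0.
have s2 : 0 <= E2.
  by rewrite -(pmulr_rge0 _ c2p); apply: le_trans k2; rewrite !addr_ge0 ?sqr_ge0.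
have s3 : 0 <= E3.
  by rewrite -(pmulr_rge0 _ c3p); apply: le_trans k3; rewrite !addr_ge0 ?sqr_ge0.
clearbody c0 c1 c2 c3; rewrite !(mulrDl _ _ (E0 + E1 + E2 + E3)).
apply: lerD; [apply: lerD; [apply: lerD|]|].
- by apply: le_trans k0 _; apply: ler_wpM2l; [exact: ltW|lra].
- by apply: le_trans k1 _; apply: ler_wpM2l; [exact: ltW|lra].
- by apply: le_trans k2 _; apply: ler_wpM2l; [exact: ltW|lra].
- by apply: le_trans k3 _; apply: ler_wpM2l; [exact: ltW|lra].
Qed.

End Table.

(** * The high moments *)

Section Growth.
Variables (R : realType) (q eta : R).
Hypothesis q_gt0 : 0 < q.
Hypotheses (eta_gt0 : 0 < eta) (eta_le : eta <= 1 / 10).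
Notation gram_of g := (gram q (mu_table q g)).

Definition update (g : nat -> R) n M : nat -> R := fun i => if i == n then M else g i.

(** Entries of total degree below [2 n] involve no moment [x'^i x^i] with
    [i >= n]. *)
Lemma gram_of_local g g' n p r : (4 <= n)%N -> (forall i, (i < n)%N -> g i = g' i) ->
  (p.1 + p.2 + (r.1 + r.2) < n.*2)%N -> gram_of g p r = gram_of g' p r.
Proof.
move=> n4 gg' pr; rewrite /gram /mu_table; congr (_ * _).
case: eqP => [e|_]; first by apply: gg'; lia.
by rewrite gg' //; lia.
Qed.

Lemma gram_of_sym g p r : gram_of g p r = gram_of g r p.
Proof. by apply: gram_sym => i j; exact: mu_table_sym. Qed.

(** For [n >= 4] the block of degree [n] is diagonal, because the twisted moments
    have total degree 6; its entries are [q^(m^2) M], bounded below by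
    [w M]. *)
Lemma coercive_step n g : (4 <= n)%N -> coercive (gram_of g) (pairs_below n) ->
  exists M, coercive (gram_of (update g n M)) (pairs_below n.+1).
Proof.
move=> n4 cg; pose w := (q / (1 + q)) ^+ (n * n)%N.
have q1 : 0 < 1 + q by rewrite addr_gt0.
have qq0 : 0 < q / (1 + q) by rewrite divr_gt0.
have w0 : 0 < w by rewrite exprn_gt0.
have wq m : (m <= n)%N -> w <= q ^+ (m * m)%N.
  move=> mn; apply: (@le_trans _ _ ((q / (1 + q)) ^+ (m * m)%N)).
    apply: ler_wiXn2l; [exact: ltW| |by rewrite leq_mul].
    by rewrite ler_pdivrMr // mul1r lerDr.
  apply: lerXn2r; rewrite ?nnegrE ?(ltW qq0) ?(ltW q_gt0) //.
  by rewrite ler_pdivrMr // mulrDr mulr1 lerDl mulr_ge0 // ltW.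
have upd M i : (i < n)%N -> update g n M i = g i.
  by move=> i_n; rewrite /update ltn_eqF.
apply: (@coercive_extend _ (gram_of g) (fun M => gram_of (update g n M)) _ _ w w0) cg.
- move=> M p r; rewrite !mem_pairs_below => pn rn.
  by apply: (gram_of_local n4 (upd M)); rewrite -addnn -addSn leq_add // ltnW.
- move=> M p r; rewrite mem_pairs_below mem_deg_pairs => pn /eqP rn.
  by apply: (gram_of_local n4 (upd M)); rewrite -addnn rn ltn_add2r.
- by move=> M p r _ _; exact: gram_of_sym.
move=> M a M0; rewrite /gram_form /sqsum mulr_sumr big_seq [leRHS]big_seq.
apply: ler_sum => p pn.
have pn' : (p.1 + p.2 == n)%N by rewrite -mem_deg_pairs.
rewrite (bigD1_seq p) //=; last first.
  by have := uniq_pairs_below n.+1; rewrite /= cat_uniq => /and3P[].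
rewrite big_seq_cond big1 => [|r /andP[]]; last first.
  rewrite mem_deg_pairs => /eqP rn rp; rewrite /gram /mu_table ifF; last first.
    apply/negbTE/eqP => e; case/eqP: rp; case: p r pn' rn e {pn} => i j [k l] /= *.
    by congr (_, _); lia.
  rewrite ifF ?mulr0 //; apply/negbTE/negP; rewrite /twisted; move: pn' rn => /eqP.
  case: p r {pn rp} => [i j] [k l] /= ij kl.
  by case/orP => /andP[/eqP e1 /eqP e2]; lia.
rewrite addr0 /gram /mu_table ifT; last by apply/eqP; lia.
rewrite /update ifT; last by rewrite addnC.
have := wq p.1 _; move=> /(_ ltac:(lia)) h.
have := ler_wpM2r (mulr_ge0 M0 (sqr_ge0 (a p))) h; lra.
Qed.

Lemma eq_coercive_below n g g' : (4 <= n)%N -> (forall i, (i < n)%N -> g i = g' i) ->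
  coercive (gram_of g) (pairs_below n) -> coercive (gram_of g') (pairs_below n).
Proof.
move=> n4 gg'; apply: eq_coercive => p r; rewrite !mem_pairs_below => pn rn.
by apply: (gram_of_local n4 gg'); rewrite -addnn -addSn leq_add // ltnW.
Qed.

(** Each step changes a moment that no earlier Gram matrix contains, so the
    sequence of tables stabilises. *)
Lemma growing_moments (g0 : nat -> R) : low_moments q eta g0 ->
  exists g, low_moments q eta g /\ forall n, coercive (gram_of g) (pairs_below (n + 4)%N).
Proof.
move=> lg0.
have /choice[f fP] : forall ng : nat * (nat -> R), exists M,
    (4 <= ng.1)%N -> coercive (gram_of ng.2) (pairs_below ng.1) ->
    coercive (gram_of (update ng.2 ng.1 M)) (pairs_below ng.1.+1).
  move=> [n g] /=; have [n4|n4] := leqP 4 n; last by exists 0.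
  have [cg|cg] := pselect (coercive (gram_of g) (pairs_below n)); last by exists 0.
  by have [M MP] := coercive_step n4 cg; exists M.
pose fix s n := if n is k.+1 then update (s k) (k + 4)%N (f ((k + 4)%N, s k)) else g0.
have sP n : coercive (gram_of (s n)) (pairs_below (n + 4)%N).
  elim: n => [|n IH]; first exact: (coercive_base q_gt0 eta_gt0 eta_le lg0).
  by rewrite addSn; apply: (fP ((n + 4)%N, s n)) => //=; rewrite leq_addl.
have s_stable n k i : (i < n + 4)%N -> s (n + k)%N i = s n i.
  move=> i_n; elim: k => [|k IH]; first by rewrite addn0.
  rewrite addnS /= /update ltn_eqF; first exact: IH.
  by rewrite addnAC ltn_addr.
pose g i := s i i.
have gs n i : (i < n + 4)%N -> s n i = g i.
  move=> i_n; rewrite /g; have [ni|/ltnW ni] := leqP n i.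
    by have := s_stable n (i - n)%N i i_n; rewrite subnKC.
  have i4 : (i < i + 4)%N by rewrite -[X in (X < _)%N]addn0 ltn_add2l.
  by have := s_stable i (n - i)%N i i4; rewrite subnKC.
exists g; split.
  by case: lg0 => *; rewrite /low_moments -!(gs 0%N).
move=> n; apply: (@eq_coercive_below _ (s n)) (sP n); first by rewrite leq_addl.
exact: gs.
Qed.

End Growth.

(** * A positive functional that is not a q-moment functional *)

Section Value.
Variables (R : realType) (q : R).

Lemma moment_square (mu : nat -> nat -> R) (mu_sym : forall i j, mu i j = mu j i)
    (c d : R) p r :
  let a := c%:C *: mono q p + d%:C *: mono q r in
  moment_functional q mu (qplane_star a * a) =
  (c ^+ 2 * gram q mu p p + 2 * c * d * gram q mu p r + d ^+ 2 * gram q mu r r)%:C.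
Proof.
have conjR (z : R) : Num.conj z%:C = z%:C by apply/CrealP/complex_realP; exists z.
rewrite /= qplane_starD !qplane_starZ !conjR mulrDl !mulrDr.
rewrite -!scalerAl -!scalerAr !scalerA !linearD !linearZ /= !moment_mono //.
rewrite (gram_sym q mu_sym r p) !rmorphD !rmorphM /= !rmorphXn /=; ring.
Qed.

Lemma witness_value_moment (eta : R) g : 0 < q -> low_moments q eta g ->
  witness_value (moment_functional q (mu_table q g)) =
  kcoef q * eta + 1 / 8 + 3 / 4 - (1 + eta).
Proof.
move=> q0 [g0 g1 g2 g3]; have qu : q != 0 by rewrite gt_eqF.
have sym := mu_table_sym q g.
have one_mul r : moment_functional q (mu_table q g) (mono q r) =
    (gram q (mu_table q g) (0, 0)%N r)%:C.
  by rewrite -moment_mono // mono00 star1 mul1r.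
have np : npol q = 1%:C *: mono q (1, 1)%N + (-1)%:C *: mono q (0, 0)%N.
  by rewrite /npol rmorph1 scale1r mono00.
rewrite /witness_value np -(mono00 q) !one_mul /vpol !moment_square // moment_mono //.
rewrite /= /gram /mu_table /= g0 g1 g2 g3.
by field.
Qed.

End Value.

Theorem theorem4 (R : realType) (q : R) (q_gt0 : 0 < q) :
  exists F : {scalar qplane q},
    positive_functional F /\ ~ q_moment_functional F.
Proof.
have k1 : 1 <= kcoef q by rewrite /kcoef; have := sqr_ge0 (ccoef q); lra.
(* the value of [witness_value_moment] is negative once [kcoef * eta <= 1/8] *)
pose eta := (16 * kcoef q)^-1.
have k0 : 0 < 16 * kcoef q by lra.
have eta0 : 0 < eta by rewrite invr_gt0.
have keta : kcoef q * eta = 1 / 16.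
  by rewrite /eta; field; rewrite gt_eqF //; lra.
have eta1 : eta <= 1 / 10.
  by rewrite /eta div1r lef_pV2 ?posrE //; lra.
pose g0 i : R := [:: 1; 1; (1 + eta) / q; 10 / q ^+ 3]`_i.
have [|g [lg cg]] := @growing_moments R q eta q_gt0 eta0 eta1 g0; first by split.
have sym := mu_table_sym q g.
exists (moment_functional q (mu_table q g)); split.
  apply: (moment_functional_positive sym (L := fun n => pairs_below (n + 4)%N)).
  - by move=> n; exact: uniq_pairs_below.
  - move=> s; have [n sn] := pairs_below_cover s; exists n => p /sn.
    by rewrite !mem_pairs_below => /leq_trans; apply; exact: leq_addr.
  - by move=> n a; exact: coercive_ge0.
move=> /(q_moment_witness q_gt0); rewrite (witness_value_moment q_gt0 lg) keta; lra.
Qed.
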